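(* Fix any $\epsilon\in(0,\frac12)$ and any $\gamma\leq 1-\log_2(1+2^{-4\epsilon})$. Then any doubly transitive linear code $C\subseteq\mathbb{F}_2^N$ of dimension $\dim C=(1-\gamma)N$ can with high probability list-decode $\epsilon$-errors using a list $T$ of size $|T|=2^{h(\epsilon)N-\gamma N+o(N)}$. Explicitly: there are functions $k(N)=2^{h(\epsilon)N-\gamma N+o(N)}$ and $p(N)\to0$ as $N\to\infty$, depending only on $\epsilon$ and $\gamma$, such that for every doubly transitive linear code $C\subseteq\mathbb{F}_2^N$ with $\dim C=(1-\gamma)N$ there is a map $T$ assigning to each $x\in\mathbb{F}_2^N$ a subset $T(x)\subseteq C$ with $|T(x)|\leq k(N)$, such that for every $c\in C$, $\Pr_{\rho\sim P_\epsilon}[c\notin T(c+\rho)]\leq p(N)$.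
   Context: $h(\epsilon)=\epsilon\log_2\frac1\epsilon+(1-\epsilon)\log_2\frac1{1-\epsilon}$. $P_\epsilon$ is the distribution on $\mathbb{F}_2^N$ given by $P_\epsilon(z)=\epsilon^{\mathrm{wt}(z)}(1-\epsilon)^{N-\mathrm{wt}(z)}$, where $\mathrm{wt}$ is Hamming weight. A linear code is a linear subspace of $\mathbb{F}_2^N$. A code $C\subseteq\mathbb{F}_2^N$ is doubly transitive if for all $i,j,k,\ell\in\{1,\dots,N\}$ with $i\neq k$ and $j\neq\ell$ there is a permutation $\pi$ of $\{1,\dots,N\}$ with $\pi(i)=j$ and $\pi(k)=\ell$ such that $(v_{\pi(1)},\dots,v_{\pi(N)})\in C$ for every $(v_1,\dots,v_N)\in C$. *)

(* Defs.v *)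
From mathcomp Require Import all_boot all_order all_algebra all_fingroup.
From mathcomp Require Import all_classical all_reals all_analysis.
Set Implicit Arguments.
Unset Strict Implicit.
Unset Printing Implicit Defensive.
Import Order.TTheory GRing.Theory Num.Theory.
Import numFieldNormedType.Exports.
Local Open Scope ring_scope.

Definition log2 (R : realType) (x : R) : R := ln x / ln 2.

Definition binary_entropy (R : realType) (eps : R) : R :=
  eps * log2 (1 / eps) + (1 - eps) * log2 (1 / (1 - eps)).

Definition hamming_weight (N : nat) (z : 'rV['F_2]_N) : nat :=
  #|[set i : 'I_N | z 0 i != 0]|.

Definition noise_mass (R : realType) (eps : R) (N : nat)
    (z : 'rV['F_2]_N) : R :=
  eps ^+ hamming_weight z * (1 - eps) ^+ (N - hamming_weight z).

Definition noise_prob (R : realType) (eps : R) (N : nat)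
    (A : {set 'rV['F_2]_N}) : R :=
  \sum_(z in A) noise_mass eps z.

(* [col_perm s v] is the row vector (v_(s(1)), ..., v_(s(N))). *)
Definition doubly_transitive (N : nat) (C : {vspace 'rV['F_2]_N}) : Prop :=
  forall i j k l : 'I_N, i != k -> j != l ->
  exists s : 'S_N, [/\ s i = j, s k = l &
    forall v : 'rV['F_2]_N, v \in C -> col_perm s v \in C].

(* Main.v *)
(* Let D be the dual of C.  By Poisson summation the expected number of codewords c with
   wt(c + rho) <= eps N + o(N), rho a typical noise vector, is at most 2^(o(N)) times
   2^(h(eps) N) #|C| / 2^N times the sum over d in D of the squared Fourier coefficients at d
   of the truncated noise.  Matching the coordinates where d is 1 with coordinates where d is 0
   shows that such a coefficient is at most (eps^2 + (1 - eps)^2)^min(wt d, N - wt d), and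
   eps^2 + (1 - eps)^2 <= 2^(-2 eps).  So it suffices that the weight enumerator of D at
   t = 2^(-4 eps) is 2^(o(N)).

   If 2^lam = 1 + t, induction on the length bounds ln (sum_{d in D} t^(wt d)) by the
   expectation of ln #{d in D supported in S}, S a lam-random set of coordinates.  The derivative
   of this expectation in lam is N ln 2 times the probability h(lam) that S + {i} supports a
   word of D with i-th bit 1, which by transitivity does not depend on i.  This is a monotone
   event invariant under a transitive group on the other coordinates, hence has a sharp
   threshold (Falik and Samorodnitsky's proof via the logarithmic Sobolev inequality).  As
   the integral of h over [0, 1] is 1 - rate(C) = gamma, the threshold is at 1 - gamma,
   and lam <= 1 - gamma. *)
Require Import Defs.
From mathcomp Require Import all_boot all_order all_algebra all_fingroup.
From mathcomp Require Import finfield.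
From mathcomp Require Import all_classical all_reals all_analysis.
From mathcomp Require Import ring lra zify.
Set Implicit Arguments.
Unset Strict Implicit.
Unset Printing Implicit Defensive.
Import Order.TTheory GRing.Theory Num.Theory.
Import numFieldNormedType.Exports.
Local Open Scope ring_scope.

(** * The biased cube *)

Lemma F2_cases (x : 'F_2) : (x == 0) || (x == 1).
Proof. by case: x => [[|[|m]] //= Hm]. Qed.

Lemma F2_neq0 (x : 'F_2) : (x != 0) = (x == 1).
Proof. by case/orP: (F2_cases x) => /eqP ->. Qed.

Lemma F2_addxx (x : 'F_2) : x + x = 0.
Proof. by case/orP: (F2_cases x) => /eqP ->; apply/val_inj. Qed.

Lemma row2_addxx n (v : 'rV['F_2]_n) : v + v = 0.
Proof. by apply/rowP => i; rewrite !mxE F2_addxx. Qed.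

Lemma row2_oppx n (v : 'rV['F_2]_n) : - v = v.
Proof. by apply/eqP; rewrite eq_sym -addr_eq0 row2_addxx. Qed.

Definition ccons n (x : 'F_2) (v : 'rV['F_2]_n) : 'rV['F_2]_n.+1 :=
  \row_j (if unlift ord0 j is Some k then v 0 k else x).

Definition ctail n (v : 'rV['F_2]_n.+1) : 'rV['F_2]_n :=
  \row_j v 0 (lift ord0 j).

Lemma ccons0E n x (v : 'rV['F_2]_n) : ccons x v 0 ord0 = x.
Proof. by rewrite mxE unlift_none. Qed.

Lemma cconsSE n x (v : 'rV['F_2]_n) j : ccons x v 0 (lift ord0 j) = v 0 j.
Proof. by rewrite mxE liftK. Qed.

Lemma ccons_tail n (v : 'rV['F_2]_n.+1) : ccons (v 0 ord0) (ctail v) = v.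
Proof. by apply/rowP => j; rewrite mxE; case: unliftP => [k|] ->; rewrite ?mxE. Qed.

Lemma ctailK n x (v : 'rV['F_2]_n) : ctail (ccons x v) = v.
Proof. by apply/rowP => j; rewrite mxE cconsSE. Qed.

Lemma ccons_add n x y (u v : 'rV['F_2]_n) :
  ccons x u + ccons y v = ccons (x + y) (u + v).
Proof. by apply/rowP => j; rewrite !mxE; case: unlift => [k|]; rewrite ?mxE. Qed.

Lemma ccons00 n : ccons 0 (0 : 'rV['F_2]_n) = 0.
Proof. by apply/rowP => j; rewrite !mxE; case: unlift => [k|]; rewrite ?mxE. Qed.

Lemma sum_ccons (V : nmodType) n (F : 'rV['F_2]_n.+1 -> V) :
  \sum_z F z = \sum_v F (ccons 1 v) + \sum_v F (ccons 0 v).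
Proof.
rewrite (bigID (fun z : 'rV['F_2]_n.+1 => z 0 ord0 == 1)) /=; congr (_ + _).
- rewrite (reindex (ccons 1)) /=; first by apply: eq_bigl => v; rewrite ccons0E eqxx.
  exists (@ctail n) => v; first by rewrite ctailK.
  by rewrite inE => /eqP <-; rewrite ccons_tail.
- rewrite (reindex (ccons 0)) /=.
    by apply: eq_bigl => v; rewrite ccons0E.
  exists (@ctail n) => v; first by rewrite ctailK.
  by rewrite inE -F2_neq0 negbK => /eqP <-; rewrite ccons_tail.
Qed.

Lemma sum_row0 (V : nmodType) (F : 'rV['F_2]_0 -> V) : \sum_z F z = F 0.
Proof.
rewrite (bigD1 0) //= big1 ?addr0 // => v /negP[].
by apply/eqP/rowP; case.
Qed.

Lemma hamming_weightE n (v : 'rV['F_2]_n) :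
  hamming_weight v = (\sum_(i < n) (v 0 i != 0)%R)%N.
Proof. by rewrite /hamming_weight -sum1dep_card big_mkcond. Qed.

Lemma hamming_weight_le n (v : 'rV['F_2]_n) : (hamming_weight v <= n)%N.
Proof. by rewrite /hamming_weight -[X in (_ <= X)%N]card_ord max_card. Qed.

Lemma hamming_weight_ccons n x (v : 'rV['F_2]_n) :
  hamming_weight (ccons x v) = ((x != 0)%R + hamming_weight v)%N.
Proof.
rewrite !hamming_weightE big_ord_recl ccons0E; congr (_ + _)%N.
by apply: eq_bigr => i _; rewrite cconsSE.
Qed.

Section Expectation.
Variable R : realType.
Implicit Types p : R.

Lemma noise_mass_ccons p n x (v : 'rV['F_2]_n) :
  noise_mass p (ccons x v) = (if x == 0 then 1 - p else p) * noise_mass p v.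
Proof.
rewrite /noise_mass hamming_weight_ccons; case: eqVneq => _ /=.
  by rewrite add0n subSn ?hamming_weight_le // exprS mulrCA.
by rewrite add1n subSS exprS mulrA.
Qed.

Lemma noise_mass_ge0 p n (v : 'rV['F_2]_n) : 0 <= p <= 1 -> 0 <= noise_mass p v.
Proof. by move=> /andP[p0 p1]; rewrite mulr_ge0 // exprn_ge0 // subr_ge0. Qed.

(** One product measure in two roles: at [p = eps] it is the noise, at [p = lam] its vectors are
    random sets of coordinates. *)
Definition expect p n (f : 'rV['F_2]_n -> R) : R := \sum_z noise_mass p z * f z.

Lemma expect_ccons p n (f : 'rV['F_2]_n.+1 -> R) :
  expect p f = p * expect p (fun v => f (ccons 1 v)) +
    (1 - p) * expect p (fun v => f (ccons 0 v)).
Proof.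
rewrite /expect sum_ccons !mulr_sumr; congr (_ + _); apply: eq_bigr => v _;
  by rewrite noise_mass_ccons ?eqxx ?oner_eq0 -mulrA.
Qed.

Lemma expect_row0 p (f : 'rV['F_2]_0 -> R) : expect p f = f 0.
Proof.
rewrite /expect sum_row0 /noise_mass.
have /eqP -> : hamming_weight (0 : 'rV['F_2]_0) == 0%N.
  by rewrite -leqn0; exact: hamming_weight_le.
by rewrite !expr0 !mul1r.
Qed.

Lemma eq_expect p n (f g : 'rV['F_2]_n -> R) : f =1 g -> expect p f = expect p g.
Proof. by move=> fg; apply: eq_bigr => z _; rewrite fg. Qed.

Lemma expectD p n (f g : 'rV['F_2]_n -> R) :
  expect p (fun z => f z + g z) = expect p f + expect p g.
Proof. by rewrite /expect -big_split; apply: eq_bigr => z _; rewrite mulrDr. Qed.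

Lemma expectZ p n a (f : 'rV['F_2]_n -> R) :
  expect p (fun z => a * f z) = a * expect p f.
Proof. by rewrite /expect mulr_sumr; apply: eq_bigr => z _; rewrite mulrCA. Qed.

Lemma expectB p n (f g : 'rV['F_2]_n -> R) :
  expect p (fun z => f z - g z) = expect p f - expect p g.
Proof. by rewrite /expect -sumrB; apply: eq_bigr => z _; rewrite mulrBr. Qed.

Lemma expect_cst p n (a : R) : expect p (fun _ : 'rV['F_2]_n => a) = a.
Proof. elim: n => [|n IHn]; rewrite ?expect_row0 // expect_ccons /= !IHn; ring. Qed.

Lemma ler_expect p n (f g : 'rV['F_2]_n -> R) : 0 <= p <= 1 ->
  (forall z, f z <= g z) -> expect p f <= expect p g.
Proof. by move=> p01 fg; apply: ler_sum => z _; rewrite ler_wpM2l ?noise_mass_ge0. Qed.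

Lemma expect_ge0 p n (f : 'rV['F_2]_n -> R) : 0 <= p <= 1 ->
  (forall z, 0 <= f z) -> 0 <= expect p f.
Proof. by move=> p01 f0; apply: sumr_ge0 => z _; rewrite mulr_ge0 ?noise_mass_ge0. Qed.

Definition upd n (z : 'rV['F_2]_n) (j : 'I_n) (x : 'F_2) : 'rV['F_2]_n :=
  \row_k (if k == j then x else z 0 k).

Lemma upd_ccons0 n x y (v : 'rV['F_2]_n) : upd (ccons x v) ord0 y = ccons y v.
Proof. by apply/rowP => k; rewrite !mxE; case: unliftP => [k'|] ->. Qed.

Lemma upd_cconsS n x y (v : 'rV['F_2]_n) j :
  upd (ccons x v) (lift ord0 j) y = ccons x (upd v j y).
Proof.
apply/rowP => k; rewrite !mxE; case: unliftP => [k'|] -> //.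
by rewrite (inj_eq lift_inj) mxE.
Qed.

(** A discrete partial derivative, independent of [z 0 j]. For the indicator of an increasing event
    its mean is the influence of [j]. *)
Definition bit_diff n (j : 'I_n) (f : 'rV['F_2]_n -> R) (z : 'rV['F_2]_n) : R :=
  f (upd z j 1) - f (upd z j 0).

Lemma diff_ccons0 n (f : 'rV['F_2]_n.+1 -> R) x v :
  bit_diff ord0 f (ccons x v) = f (ccons 1 v) - f (ccons 0 v).
Proof. by rewrite /bit_diff !upd_ccons0. Qed.

Lemma diff_cconsS n j (f : 'rV['F_2]_n.+1 -> R) x v :
  bit_diff (lift ord0 j) f (ccons x v) = bit_diff j (f \o ccons x) v.
Proof. by rewrite /bit_diff !upd_cconsS. Qed.

(** [G] stays open: squares serve the energy estimates, the identity serves Russo's formula. *)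
Lemma sum_expect_diff (G : R -> R) p n (f : 'rV['F_2]_n.+1 -> R) :
  \sum_j expect p (fun z => G (bit_diff j f z)) =
  expect p (fun v => G (f (ccons 1 v) - f (ccons 0 v))) +
  (p * \sum_j expect p (fun v => G (bit_diff j (f \o ccons 1) v)) +
   (1 - p) * \sum_j expect p (fun v => G (bit_diff j (f \o ccons 0) v))).
Proof.
rewrite big_ord_recl; congr (_ + _).
  rewrite expect_ccons; under [in X in p * X]eq_expect do rewrite /= diff_ccons0.
  by under [in X in (1 - p) * X]eq_expect do rewrite /= diff_ccons0; ring.
rewrite !mulr_sumr -big_split; apply: eq_bigr => j _ /=; rewrite expect_ccons.
by congr (_ * _ + _ * _); apply: eq_expect => v /=; rewrite diff_cconsS.
Qed.

Lemma cauchy_schwarz_expect p n (f g : 'rV['F_2]_n -> R) : 0 <= p <= 1 ->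
  expect p (fun z => f z * g z) ^+ 2 <=
  expect p (fun z => f z ^+ 2) * expect p (fun z => g z ^+ 2).
Proof.
move=> p01; set a := expect p (fun z => f z ^+ 2).
set b := expect p (fun z => f z * g z); set c := expect p (fun z => g z ^+ 2).
have q t : 0 <= t ^+ 2 * a - 2 * t * b + c.
  rewrite /a /b /c -!expectZ -expectB -expectD; apply: expect_ge0 => // z.
  by rewrite (_ : _ + _ = (t * f z - g z) ^+ 2) ?sqr_ge0 //; ring.
have a0 : 0 <= a by apply: expect_ge0 => // z; apply: sqr_ge0.
have [a_eq0|a_neq0] := eqVneq a 0.
  (* With [a = 0] the quadratic is affine in [t]; at this [t] it would equal -1 unless [b = 0]. *)
  have := q ((c + 1) / 2 / b); rewrite a_eq0.
  have [->|b_neq0] := eqVneq b 0; first by rewrite expr0n /= mul0r.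
  by rewrite (_ : 2 * _ * _ = c + 1); [lra | field].
have := q (b / a); rewrite (_ : _ + c = (a * c - b ^+ 2) / a); last by field.
by rewrite pmulr_lge0 ?subr_ge0 // invr_gt0 lt_neqAle eq_sym a_neq0.
Qed.

End Expectation.

(** * Logarithmic Sobolev inequality and influences *)

Section LogSobolev.
Variable R : realType.
Implicit Types p a b c x : R.

Definition xlnx x : R := x * ln x.

Definition cube_entropy p n (f : 'rV['F_2]_n -> R) : R :=
  expect p (fun z => xlnx (f z)) - xlnx (expect p f).

Lemma ln_le_subr1 x : 0 < x -> ln x <= x - 1.
Proof.
move=> x0; have := @expR_ge1Dx R (ln x); rewrite lnK ?posrE //; lra.
Qed.

(* [ln t <= t - 1] bounds the entropy by [Var (F^2) / E (F^2)]. *)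
Lemma two_point_log_sobolev p a b : 0 <= p <= 1 -> 0 <= a -> 0 <= b ->
  p * xlnx (a ^+ 2) + (1 - p) * xlnx (b ^+ 2)
    - xlnx (p * a ^+ 2 + (1 - p) * b ^+ 2) <= 2 * (a - b) ^+ 2.
Proof.
move=> /andP[p0 p1] a0 b0; set m := p * a ^+ 2 + (1 - p) * b ^+ 2.
have q0 : 0 <= 1 - p by rewrite subr_ge0.
have m0 : 0 <= m by rewrite addr_ge0 // mulr_ge0 ?sqr_ge0.
have [m_eq0|m_neq0] := eqVneq m 0.
  have /andP[/eqP pa /eqP qb] : (p * a ^+ 2 == 0) && ((1 - p) * b ^+ 2 == 0).
    by rewrite -paddr_eq0 ?mulr_ge0 ?sqr_ge0 // -/m m_eq0.
  have -> : p * xlnx (a ^+ 2) = 0 by rewrite /xlnx (mulrA p) pa mul0r.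
  have -> : (1 - p) * xlnx (b ^+ 2) = 0 by rewrite /xlnx (mulrA (1 - p)) qb mul0r.
  by rewrite m_eq0 /xlnx mul0r; have := sqr_ge0 (a - b); lra.
have m_gt0 : 0 < m by rewrite lt_neqAle eq_sym m_neq0.
have key w x : 0 <= w -> w * xlnx (x ^+ 2) - w * x ^+ 2 * ln m
    <= w * x ^+ 2 * (x ^+ 2 / m - 1).
  move=> w0; have [->|x0] := eqVneq x 0.
    by rewrite /xlnx expr0n /= !(mul0r, mulr0) subr0.
  have x2 : 0 < x ^+ 2 by rewrite exprn_even_gt0 //= x0.
  rewrite /xlnx (mulrA w) -mulrBr -ln_div ?posrE // ler_wpM2l ?(mulr_ge0 w0 (sqr_ge0 x)) //.
  by apply/ln_le_subr1/divr_gt0.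
have := lerD (key p a p0) (key (1 - p) b q0).
have -> : p * xlnx (a ^+ 2) - p * a ^+ 2 * ln m +
    ((1 - p) * xlnx (b ^+ 2) - (1 - p) * b ^+ 2 * ln m) =
    p * xlnx (a ^+ 2) + (1 - p) * xlnx (b ^+ 2) - xlnx m.
  by rewrite [xlnx m]/xlnx /m; ring.
move=> /le_trans; apply.
have -> : p * a ^+ 2 * (a ^+ 2 / m - 1) + (1 - p) * b ^+ 2 * (b ^+ 2 / m - 1) =
    (a - b) ^+ 2 * (p * (1 - p) * (a + b) ^+ 2 / m).
  by rewrite /m; field.
rewrite [leRHS]mulrC ler_wpM2l ?sqr_ge0 // ler_pdivrMr //.
have ab : 2 * (a ^+ 2 + b ^+ 2) - (a + b) ^+ 2 = (a - b) ^+ 2 by ring.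
have pq0 : 0 <= p * (1 - p) by rewrite mulr_ge0.
apply: (@le_trans _ _ (p * (1 - p) * (2 * (a ^+ 2 + b ^+ 2)))).
  by rewrite ler_wpM2l // -subr_ge0 ab sqr_ge0.
rewrite -subr_ge0 (_ : _ - _ = 2 * (p ^+ 2 * a ^+ 2 + (1 - p) ^+ 2 * b ^+ 2)); last first.
  by rewrite /m; ring.
by rewrite mulr_ge0 // addr_ge0 // mulr_ge0 // sqr_ge0.
Qed.

(** Condition on the first bit. Induction bounds the entropies of the two halves, and the two-point
    inequality at the square roots of [E1] and [E0] bounds the entropy between them. By
    Cauchy-Schwarz the squared difference of these roots is at most the energy in the first
    coordinate. *)
Lemma log_sobolev p n (g : 'rV['F_2]_n -> R) : 0 <= p <= 1 ->
  cube_entropy p (fun z => g z ^+ 2) <= 2 * \sum_j expect p (fun z => bit_diff j g z ^+ 2).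
Proof.
move=> p01; elim: n g => [|n IHn] g.
  by rewrite /cube_entropy !expect_row0 subrr big_ord0 mulr0.
rewrite (sum_expect_diff (fun x => x ^+ 2)) /cube_entropy !expect_ccons /=.
set g1 := g \o ccons 1; set g0 := g \o ccons 0.
have := IHn g1; have := IHn g0; rewrite /cube_entropy.
set S0 := \sum_j _; set S1 := \sum_j _.
set X1 := expect p (fun z => xlnx (g1 z ^+ 2)); set X0 := expect p (fun z => xlnx (g0 z ^+ 2)).
set E1 := expect p (fun z => g1 z ^+ 2); set E0 := expect p (fun z => g0 z ^+ 2).
have E1_ge0 : 0 <= E1 by apply: expect_ge0 => // z; apply: sqr_ge0.
have E0_ge0 : 0 <= E0 by apply: expect_ge0 => // z; apply: sqr_ge0.
move=> ih0 ih1.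
have := @two_point_log_sobolev p (Num.sqrt E1) (Num.sqrt E0) p01 (sqrtr_ge0 _) (sqrtr_ge0 _).
rewrite !sqr_sqrtr //.
have -> : expect p (fun v => (g (ccons 1 v) - g (ccons 0 v)) ^+ 2) =
    E1 + E0 - 2 * expect p (fun v => g1 v * g0 v).
  rewrite /E1 /E0 -expectZ -expectD -expectB; apply: eq_expect => v /=.
  by rewrite /g1 /g0 /=; ring.
have : expect p (fun v => g1 v * g0 v) <= Num.sqrt E1 * Num.sqrt E0.
  rewrite (le_trans (ler_norm _)) // -sqrtrM // -sqrtr_sqr ler_sqrt ?mulr_ge0 //.
  exact: cauchy_schwarz_expect.
set G := expect p _ => cs.
have -> : (Num.sqrt E1 - Num.sqrt E0) ^+ 2 = E1 + E0 - 2 * (Num.sqrt E1 * Num.sqrt E0).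
  by rewrite sqrrB !sqr_sqrtr //; ring.
case/andP: p01 => p0 p1.
have i1 := ler_wpM2l p0 ih1.
have q0 : 0 <= 1 - p by rewrite subr_ge0.
have i0 := ler_wpM2l q0 ih0.
move: i1 i0 cs; rewrite !mulrBr.
set w := Num.sqrt E1 * _; set x1 := xlnx E1; set x0 := xlnx E0.
set y := xlnx (_ + _); set A := p * X1; set B := _ * X0; set A' := _ * x1; set B' := _ * x0.
have -> : p * (2 * S1) = 2 * (p * S1) by ring.
have -> : (1 - p) * (2 * S0) = 2 * ((1 - p) * S0) by ring.
set P := p * S1; set Q := (1 - p) * S0; lra.
Qed.

(** Integrating [ln x <= x - 1] at [x = a / |g z|] with weight [2 (g z)^2], where [a^2 = c v], gives
    the bound up to a perfect square. Hence entropy is large when the first absolute moment is small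
    against the second. *)
Lemma entropy_sqr_ge p n (g : 'rV['F_2]_n -> R) c : 0 <= p <= 1 -> 0 < c ->
  expect p (fun z => g z ^+ 2) * (1 + ln c)
    - c * expect p (fun z => `|g z|) ^+ 2 <= cube_entropy p (fun z => g z ^+ 2).
Proof.
move=> p01 c0; rewrite /cube_entropy; set v := expect p (fun z => g z ^+ 2).
set m := expect p (fun z => `|g z|).
have v0 : 0 <= v by apply: expect_ge0 => // z; apply: sqr_ge0.
have [v_eq0|v_neq0] := eqVneq v 0.
  rewrite v_eq0 /xlnx !mul0r sub0r subr0.
  rewrite [leRHS](_ : _ = 0); last first.
    apply: big1 => z _; rewrite mulrA.
    suff /(_ z isT) -> : forall z, true -> noise_mass p z * g z ^+ 2 = 0 by rewrite mul0r.
    by apply/psumr_eq0P => // {}z _; rewrite mulr_ge0 ?sqr_ge0 ?noise_mass_ge0.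
  by rewrite oppr_le0 mulr_ge0 ?sqr_ge0 // ltW.
have v_gt0 : 0 < v by rewrite lt_neqAle eq_sym v_neq0.
pose a := Num.sqrt c * Num.sqrt v.
have a_gt0 : 0 < a by rewrite mulr_gt0 // sqrtr_gt0.
have pt z : 2 * ln a * g z ^+ 2 + 2 * g z ^+ 2 - 2 * a * `|g z| <= xlnx (g z ^+ 2).
  rewrite -[g z ^+ 2]real_normK ?num_real //; move: `|g z| (normr_ge0 (g z)) => y.
  rewrite le_eqVlt => /predU1P[<-|y0].
    by rewrite /xlnx expr0n /= !(mulr0, mul0r) !(addr0, subr0).
  have y0' : y != 0 by rewrite gt_eqF.
  have := ln_le_subr1 (divr_gt0 a_gt0 y0); rewrite ln_div ?posrE // => h.
  have := ler_wpM2l (sqr_ge0 y) h.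
  rewrite /xlnx lnXn // (_ : _ * (a / y - 1) = a * y - y ^+ 2); last by field.
  rewrite -[ln y *+ 2]mulr_natl mulrBr; set A := y ^+ 2 * ln a.
  set B := y ^+ 2 * ln y => hh.
  have -> : y ^+ 2 * (2%:R * ln y) = 2 * B by rewrite /B; ring.
  have -> : 2 * ln a * y ^+ 2 = 2 * A by rewrite /A; ring.
  lra.
have := ler_expect p01 pt.
rewrite expectB expectD !expectZ -/v -/m => h.
have lna : 2 * ln a = ln c + ln v.
  rewrite -[2]/(2%:R) mulr_natl -lnXn // /a exprMn !sqr_sqrtr ?ltW // lnM ?posrE //.
have sq : v - 2 * a * m + c * m ^+ 2 = (Num.sqrt v - Num.sqrt c * m) ^+ 2.
  by rewrite sqrrB exprMn !sqr_sqrtr ?ltW // /a; ring.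
have := sqr_ge0 (Num.sqrt v - Num.sqrt c * m); rewrite -sq.
rewrite lna in h; rewrite [xlnx v]/xlnx.
set X := expect p _ in h *; set A := c * m ^+ 2; set B := a * m.
rewrite -[2 * a * m]mulrA -/B in h *.
rewrite mulrDl [ln c * v]mulrC [ln v * v]mulrC in h; rewrite mulrDr mulr1.
set C := v * ln c in h *; set D := v * ln v in h *; lra.
Qed.

Definition cube_variance p n (f : 'rV['F_2]_n -> R) : R :=
  expect p (fun z => f z ^+ 2) - expect p f ^+ 2.

(* Resampling the first coordinate splits [f] into the martingale difference [d]
   and the conditional mean [fbar]; their energies add up to that of [f]. *)
Lemma falik_samorodnitsky p n (f : 'rV['F_2]_n -> R) c : 0 <= p <= 1 -> 0 < c ->
  cube_variance p f * (1 + ln c) <= 2 * \sum_j expect p (fun z => bit_diff j f z ^+ 2)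
    + c * \sum_j expect p (fun z => `|bit_diff j f z|) ^+ 2.
Proof.
move=> p01 c0; elim: n f => [|n IHn] f.
  by rewrite /cube_variance !expect_row0 subrr mul0r !big_ord0 !mulr0 addr0.
have [p0 p1] := andP p01; have q0 : 0 <= 1 - p by rewrite subr_ge0.
pose f1 := f \o ccons 1; pose f0 := f \o ccons 0.
pose fbar v := p * f1 v + (1 - p) * f0 v.
pose d (z : 'rV['F_2]_n.+1) := (if z 0 ord0 == 0 then - p else 1 - p) *
  (f1 (ctail z) - f0 (ctail z)).
have d1 v : d (ccons 1 v) = (1 - p) * (f1 v - f0 v) by rewrite /d ccons0E ctailK.
have d0 v : d (ccons 0 v) = - p * (f1 v - f0 v) by rewrite /d ccons0E ctailK eqxx.
have Vf : cube_variance p f = expect p (fun z => d z ^+ 2) + cube_variance p fbar.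
  rewrite /cube_variance !expect_ccons.
  have -> : expect p fbar = p * expect p f1 + (1 - p) * expect p f0.
    by rewrite expectD !expectZ.
  rewrite addrA; congr (_ - _).
  rewrite -!expectZ -!expectD; apply: eq_expect => v /=.
  by rewrite d1 d0 /fbar /f1 /f0 /=; ring.
have Efull : \sum_j expect p (fun z => bit_diff j f z ^+ 2) =
    \sum_j expect p (fun z => bit_diff j d z ^+ 2) +
    \sum_j expect p (fun v => bit_diff j fbar v ^+ 2).
  rewrite !(sum_expect_diff (fun x => x ^+ 2)) -addrA; congr (_ + _).
    by apply: eq_expect => v; rewrite d1 d0; congr (_ ^+ 2); rewrite /f1 /f0 /=; ring.
  rewrite !mulr_sumr -!big_split; apply: eq_bigr => j _ /=.
  rewrite -!expectZ -!expectD; apply: eq_expect => v /=.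
  by rewrite /bit_diff /= !d1 !d0 /fbar /f1 /f0 /=; ring.
rewrite Vf mulrDl Efull mulrDr.
have := le_trans (entropy_sqr_ge d p01 c0) (log_sobolev d p01).
have := IHn fbar.
rewrite [\sum_(j < n.+1) expect p (fun z => `|_|) ^+ 2]big_ord_recl mulrDr.
(* The mean of [|d|] is [2 p (1 - p) <= 1] times that of [|f1 - f0|]. *)
have i0 : expect p (fun z => `|d z|) ^+ 2 <= expect p (fun z => `|bit_diff ord0 f z|) ^+ 2.
  rewrite ler_sqr ?nnegrE ?expect_ge0 //.
  rewrite !expect_ccons -!expectZ -!expectD; apply: ler_expect => // v /=.
  rewrite d1 d0 !diff_ccons0 /f1 /f0 /=.
  set y := f _ - f _; rewrite !normrM normrN (ger0_norm p0) (ger0_norm q0).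
  have := normr_ge0 y; set Y := `|y| => Y0.
  rewrite (_ : p * ((1 - p) * Y) + _ = (2 * (p * (1 - p))) * Y); last by ring.
  rewrite (_ : p * Y + _ = 1 * Y); last by ring.
  by rewrite ler_wpM2r //; nra.
(* Averaging over the first bit does not increase an influence. *)
have i1 : \sum_(j < n) expect p (fun v => `|bit_diff j fbar v|) ^+ 2 <=
    \sum_(j < n) expect p (fun z => `|bit_diff (lift ord0 j) f z|) ^+ 2.
  apply: ler_sum => j _; rewrite ler_sqr ?nnegrE ?expect_ge0 //.
  rewrite expect_ccons -!expectZ -!expectD; apply: ler_expect => // v /=.
  rewrite !diff_cconsS {1}/bit_diff /fbar.
  rewrite (_ : _ - _ = p * bit_diff j f1 v + (1 - p) * bit_diff j f0 v); last first.
    by rewrite /bit_diff; ring.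
  by apply: le_trans (ler_normD _ _) _; rewrite !normrM (ger0_norm p0) (ger0_norm q0).
have := ler_wpM2l (ltW c0) i0; have := ler_wpM2l (ltW c0) i1; lra.
Qed.

End LogSobolev.

(** * Derivatives in the bias and Russo's formula *)

Lemma is_derive_mix (R : realType) (f g : R -> R) (x df dg : R) :
  is_derive x (1 : R) f df -> is_derive x (1 : R) g dg ->
  is_derive x (1 : R) (fun q => q * f q + (1 - q) * g q)
    (f x - g x + (x * df + (1 - x) * dg)).
Proof.
move=> fd gd.
have d1 := is_deriveM (is_derive_id x (1 : R)) fd.
have d2 := is_deriveB (is_derive_cst (1 : R) x (1 : R)) (is_derive_id x (1 : R)).
have d3 := is_deriveM d2 gd.
have d4 := is_deriveD d1 d3.
apply: is_derive_eq d4 _.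
rewrite /GRing.scale /= sub0r mulr1.
rewrite mulrN1.
rewrite -[(cst 1 - id) x]/(1 - x).
by rewrite [x * df + f x]addrC [(1 - x) * dg - g x]addrC addrACA.
Qed.

Lemma is_derive_lincomb (R : realType) (f g : R -> R) (x df dg a b c : R) :
  is_derive x (1 : R) f df -> is_derive x (1 : R) g dg ->
  is_derive x (1 : R) (fun y => a * y + (b * f y + c * g y)) (a + (b * df + c * dg)).
Proof.
move=> fd gd.
have d4 := is_deriveD (is_deriveZ a (is_derive_id x (1 : R)))
  (is_deriveD (is_deriveZ b fd) (is_deriveZ c gd)).
apply: is_derive_eq d4 _.
by rewrite /GRing.scale /= mulr1.
Qed.

(** Splitting by the first bit gives a mixture with weights [q] and [1 - q]. Differentiating the
    weights yields the first term of the sum, differentiating the halves the others. *)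
Lemma russo (R : realType) (p : R) n (f : 'rV['F_2]_n -> R) :
  is_derive p (1 : R) (fun q : R => expect q f) (\sum_j expect p (bit_diff j f)).
Proof.
elim: n f => [|n IHn] f.
  rewrite big_ord0 (_ : (fun q => _) = cst (f 0)); first exact: is_derive_cst.
  by apply/funext => q; rewrite expect_row0.
pose g1 (q : R) := expect q (f \o ccons 1); pose g0 (q : R) := expect q (f \o ccons 0).
have h1 := IHn (f \o ccons 1); have h0 := IHn (f \o ccons 0).
rewrite (_ : (fun q => _) = (fun q => q * g1 q + (1 - q) * g0 q)); last first.
  by apply/funext => q; rewrite expect_ccons.
apply: is_derive_eq (is_derive_mix h1 h0) _.
by rewrite (sum_expect_diff id) /= expectB.
Qed.

(** * Weight enumerators *)

(** Over the field with two elements, closure under addition is linearity. Plain finite sets let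
    codes, cosets and unions of slices be treated alike. *)
Definition is_code n (A : {set 'rV['F_2]_n}) : Prop :=
  0 \in A /\ forall u v, u \in A -> v \in A -> u + v \in A.

(** At 0 this is the code shortened at its first coordinate; the union of both slices is the
    punctured code. *)
Definition slice n (x : 'F_2) (A : {set 'rV['F_2]_n.+1}) : {set 'rV['F_2]_n} :=
  [set v | ccons x v \in A]%SET.

Definition translate n (x : 'rV['F_2]_n) (A : {set 'rV['F_2]_n}) : {set 'rV['F_2]_n} :=
  [set v | v + x \in A]%SET.

Lemma code_addr n (A : {set 'rV['F_2]_n}) u v : is_code A ->
  u \in A -> (v + u \in A) = (v \in A).
Proof.
move=> [A0 AD] uA; apply/idP/idP => [|vA]; last exact: AD.
by move=> /AD /(_ uA); rewrite -addrA row2_addxx addr0.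
Qed.

Lemma is_code_slice0 n (A : {set 'rV['F_2]_n.+1}) : is_code A -> is_code (slice 0 A).
Proof.
move=> [A0 AD]; split; first by rewrite inE ccons00.
by move=> u v; rewrite !inE => /AD + /[dup] vA => /(_ _ vA); rewrite ccons_add addr0.
Qed.

Lemma is_code_sliceU n (A : {set 'rV['F_2]_n.+1}) : is_code A ->
  is_code (slice 0 A :|: slice 1 A)%SET.
Proof.
move=> [A0 AD]; split; first by rewrite !inE ccons00 A0.
move=> u v; rewrite !inE => /orP[] uA /orP[] vA; have := AD _ _ uA vA;
  by rewrite ccons_add ?F2_addxx ?add0r ?addr0 => ->; rewrite ?orbT.
Qed.

(** [slice 1 A] is empty or a coset of [slice 0 A]. The cases: the first bit vanishes on [A]; the
    first unit vector lies in [A]; neither holds. *)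
Lemma slice_cases n (A : {set 'rV['F_2]_n.+1}) : is_code A ->
  [\/ slice 1 A = finset.set0, slice 1 A = slice 0 A |
      [disjoint slice 0 A & slice 1 A] /\ exists y, slice 1 A = translate y (slice 0 A)].
Proof.
move=> cA; have [->|[y]] := set_0Vmem (slice 1 A); first by constructor 1.
rewrite inE => yA.
have s1 : slice 1 A = translate y (slice 0 A).
  apply/setP => v; rewrite !inE -(code_addr _ cA yA) ccons_add F2_addxx //.
have [y0|y0] := boolP (y \in slice 0 A).
  constructor 2; rewrite s1; apply/setP => v; rewrite !inE.
  by move: y0; rewrite inE -{2}[0 : 'F_2]addr0 -ccons_add => y0; rewrite code_addr.
constructor 3; split; last by exists y.
rewrite -finset.setI_eq0; apply/eqP/setP => v; rewrite !inE; apply/andP => -[v0 v1].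
move: y0; rewrite inE => /negP; apply.
have := cA.2 _ _ v0 (cA.2 _ _ v1 yA).
by rewrite !ccons_add F2_addxx addr0 addrA row2_addxx add0r.
Qed.

Lemma slice_shift n x y (v : 'rV['F_2]_n) (A : {set 'rV['F_2]_n.+1}) :
  slice y (translate (ccons x v) A) = translate v (slice (y + x) A).
Proof. by apply/setP => u; rewrite !inE ccons_add. Qed.

Section WeightEnumerator.
Variable R : realType.
Implicit Types t lam a b : R.

Definition weight_enum t n (A : {set 'rV['F_2]_n}) : R :=
  \sum_(c in A) t ^+ hamming_weight c.

Lemma weight_enum_slice t n (A : {set 'rV['F_2]_n.+1}) :
  weight_enum t A = t * weight_enum t (slice 1 A) + weight_enum t (slice 0 A).
Proof.
rewrite /weight_enum big_mkcond sum_ccons mulr_sumr; congr (_ + _).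
  rewrite [RHS]big_mkcond; apply: eq_bigr => v _.
  by rewrite inE hamming_weight_ccons oner_eq0 add1n exprS.
rewrite [RHS]big_mkcond; apply: eq_bigr => v _.
by rewrite inE hamming_weight_ccons eqxx.
Qed.

Lemma weight_enumU t n (A B : {set 'rV['F_2]_n}) : [disjoint A & B] ->
  weight_enum t (A :|: B)%SET = weight_enum t A + weight_enum t B.
Proof.
by move=> dAB; rewrite /weight_enum -bigU //; apply: eq_bigl => c; rewrite !inE.
Qed.

Lemma weight_enum_ge0 t n (A : {set 'rV['F_2]_n}) : 0 <= t -> 0 <= weight_enum t A.
Proof. by move=> t0; apply: sumr_ge0 => c _; rewrite exprn_ge0. Qed.

Lemma weight_enum_gt0 t n (A : {set 'rV['F_2]_n}) : 0 <= t -> is_code A -> 0 < weight_enum t A.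
Proof.
move=> t0 [A0 _]; rewrite /weight_enum (bigD1 0) //= ltr_pwDl //.
  rewrite (_ : hamming_weight _ = 0%N) ?expr0 ?ltr01 //.
  by rewrite hamming_weightE big1 // => i _; rewrite mxE eqxx.
by apply: sumr_ge0 => c _; rewrite exprn_ge0.
Qed.

Lemma weight_enum0 t n : weight_enum t (finset.set0 : {set 'rV['F_2]_n}) = 0.
Proof. by rewrite /weight_enum big_set0. Qed.

(* Induction on the first coordinate: with [P], [Q] the enumerators of the shifted
   slices and [W0], [W1] those of the slices, [P, Q <= W0] and [P + Q <= W0 + W1]. *)
Lemma weight_enum_shift t n (A : {set 'rV['F_2]_n}) x : 0 <= t <= 1 -> is_code A ->
  weight_enum t (translate x A) <= weight_enum t A.
Proof.
move=> /andP[t0 t1]; elim: n A x => [|n IHn] A x cA.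
  rewrite (_ : translate x A = A) //; apply/setP => v; rewrite inE.
  by rewrite (_ : v + x = v) //; apply/rowP; case.
rewrite -(ccons_tail x) !weight_enum_slice !slice_shift.
move: (ctail x) (x 0 ord0) => v b.
set W0 := weight_enum t (slice 0 A); set W1 := weight_enum t (slice 1 A).
set P := weight_enum t (translate v (slice 0 A)).
set Q := weight_enum t (translate v (slice 1 A)).
have PW : P <= W0 by apply: IHn; exact: is_code_slice0.
have [QW PQ] : Q <= W0 /\ P + Q <= W0 + W1.
  rewrite /Q /W1; case: (slice_cases cA) => [->|->|[dA [y sA]]].
  - rewrite (_ : translate v finset.set0 = finset.set0); last by apply/setP => u; rewrite !inE.
    by rewrite !weight_enum0 weight_enum_ge0 // !addr0.
  - by split => //; apply: lerD.
  - split; last first.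
      rewrite /P /W0 -(weight_enumU t dA) -weight_enumU; last first.
        rewrite -finset.setI_eq0; apply/eqP/setP => u; rewrite !inE.
        have /setP/(_ (u + v)) : (slice 0 A :&: slice 1 A = finset.set0)%SET.
          by apply/eqP; rewrite finset.setI_eq0.
        by rewrite !inE.
      rewrite (_ : _ :|: _ = translate v (slice 0 A :|: slice 1 A))%SET; last first.
        by apply/setP => u; rewrite !inE.
      by apply: IHn; exact: is_code_sliceU.
    rewrite sA (_ : translate v _ = translate (v + y) (slice 0 A)).
      by apply: IHn; exact: is_code_slice0.
    by apply/setP => u; rewrite !inE addrA.
have t1' : 0 <= 1 - t by rewrite subr_ge0.
(* [P + t Q = (1 - t) P + t (P + Q)], and likewise with [P] and [Q] exchanged when the first bit of
   the shift is 1. *)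
have h := ler_wpM2l t0 PQ; have hP := ler_wpM2l t1' PW; have hQ := ler_wpM2l t1' QW.
case/orP: (F2_cases b) => /eqP ->; rewrite ?F2_addxx ?add0r ?addr0 -/P -/Q.
- move: h hP; rewrite !mulrDr !mulrBl; set tP := t * P; set tQ := t * Q.
  by set tW0 := t * W0; set tW1 := t * W1; lra.
- move: h hQ; rewrite !mulrDr !mulrBl; set tP := t * P; set tQ := t * Q.
  by set tW0 := t * W0; set tW1 := t * W1; lra.
Qed.

End WeightEnumerator.

Definition covers n (m c : 'rV['F_2]_n) : bool :=
  [forall j, (m 0 j == 0) ==> (c 0 j == 0)].

Definition subcode n (A : {set 'rV['F_2]_n}) (m : 'rV['F_2]_n) : {set 'rV['F_2]_n} :=
  [set c in A | covers m c]%SET.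

Lemma covers0 n (m : 'rV['F_2]_n) : covers m 0.
Proof. by apply/forallP => j; rewrite mxE eqxx implybT. Qed.

Lemma coversD n (m u v : 'rV['F_2]_n) : covers m u -> covers m v -> covers m (u + v).
Proof.
move=> /forallP mu /forallP mv; apply/forallP => j; apply/implyP => mj.
by rewrite mxE (eqP (implyP (mu j) mj)) (eqP (implyP (mv j) mj)) addr0.
Qed.

Lemma is_code_subcode n (A : {set 'rV['F_2]_n}) m : is_code A -> is_code (subcode A m).
Proof.
move=> [A0 AD]; split; first by rewrite inE A0 covers0.
by move=> u v; rewrite !inE => /andP[uA mu] /andP[vA mv]; rewrite AD // coversD.
Qed.

Lemma covers_ccons n x y (m c : 'rV['F_2]_n) :
  covers (ccons x m) (ccons y c) = ((x == 0) ==> (y == 0)) && covers m c.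
Proof.
apply/forallP/andP => [h|[xy /forallP h] j].
  split; first by have := h ord0; rewrite !ccons0E.
  by apply/forallP => j; have := h (lift ord0 j); rewrite !cconsSE.
by rewrite !mxE; case: unliftP => [k|] _ //; apply: h.
Qed.

Lemma card_subcode_ccons0 n (A : {set 'rV['F_2]_n.+1}) m :
  #|subcode A (ccons 0 m)| = #|subcode (slice 0 A) m|.
Proof.
rewrite -!sum1_card big_mkcond sum_ccons big1 ?add0r; last first.
  by move=> v _; rewrite inE covers_ccons eqxx oner_eq0 andbF.
rewrite [RHS]big_mkcond; apply: eq_bigr => v _.
by rewrite !inE covers_ccons eqxx.
Qed.

Lemma card_subcode_ccons1 n (A : {set 'rV['F_2]_n.+1}) m :
  #|subcode A (ccons 1 m)| = (#|subcode (slice 1%R A) m| + #|subcode (slice 0%R A) m|)%N.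
Proof.
rewrite -!sum1_card big_mkcond sum_ccons /=; congr (_ + _)%N;
  by rewrite [RHS]big_mkcond; apply: eq_bigr => v _; rewrite !inE covers_ccons oner_eq0.
Qed.

Section WeightBound.
Variable R : realType.
Implicit Types t lam a b : R.

(** The conditional entropy, in nats, of a uniform word of a code [A] given its bits outside [m]. *)
Definition log_card n (A : {set 'rV['F_2]_n}) (m : 'rV['F_2]_n) : R :=
  ln #|subcode A m|%:R.

Lemma card_code_gt0 n (A : {set 'rV['F_2]_n}) : is_code A -> (0 < #|A|)%N.
Proof. by move=> [A0 _]; apply/card_gt0P; exists 0. Qed.

(* The concave function [x `^ lam] and the affine one [1 - t + t * x] agree at 1 and 2. *)
Lemma chord_le_geometric_mean t lam a b : 0 < t -> 0 < lam <= 1 ->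
  expR (lam * ln 2) = 1 + t -> 0 < a -> a <= b -> b <= 2 * a ->
  (1 - t) * a + t * b <= expR ((1 - lam) * ln a + lam * ln b).
Proof.
move=> t0 /andP[l0 l1] lt a0 ab b2a.
have b0 : 0 < b by apply: lt_le_trans ab.
have w01 : 0 <= 2 - b / a <= 1.
  by rewrite subr_ge0 ler_pdivrMr // b2a /= lerBlDr -lerBlDl ler_pdivlMr //; lra.
pose w := Itv01 (proj1 (andP w01)) (proj2 (andP w01)).
have il1 : 1 <= lam^-1 by rewrite invf_ge1.
have p1 : (1 : R) \in (`[0, +oo[%classic : set R) by rewrite inE /= in_itv /= ler01.
have p2 : 1 + t \in (`[0, +oo[%classic : set R).
  by rewrite inE /= in_itv /= andbT; lra.
(* Concavity of the power [lam] is used through its inverse function, which is convex and maps 1 and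
   [1 + t] to 1 and 2. *)
have := @convex_powR R _ il1 w 1 (1 + t) p1 p2.
rewrite convRE [X in X `^ _ <= _]convRE /= powR1 /unstable.onem.
have t_gt0 : 0 < 1 + t by lra.
have -> : (1 + t) `^ lam^-1 = 2.
  by rewrite /powR gt_eqF // -lt expRK mulrA mulVf ?gt_eqF // mul1r lnK ?posrE.
set s := 2 - b / a.
have ba : b / a = 2 - s by rewrite /s; ring.
have -> : s * 1 + (1 - s) * 2 = b / a by rewrite ba; ring.
have -> : s * 1 + (1 - s) * (1 + t) = ((1 - t) * a + t * b) / a.
  by rewrite /s; field; rewrite gt_eqF.
set X := (1 - t) * a + t * b => h.
have X0 : 0 < X.
  rewrite /X; have : t * a <= t * b by rewrite ler_wpM2l // ltW.
  lra.
have Xa0 : 0 < X / a by apply: divr_gt0.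
rewrite -[leLHS]lnK ?posrE // ler_expR.
have : ln ((X / a) `^ lam^-1) <= ln (b / a).
  by rewrite ler_ln // posrE ?powR_gt0 ?divr_gt0.
rewrite ln_powR !ln_div ?posrE // ler_pdivrMl //.
by rewrite mulrBr; lra.
Qed.

(** Induction along [slice_cases]. A vanishing first bit changes neither side; a unit vector in [A]
    multiplies both bounds by [1 + t = 2^lam]. Otherwise the enumerator is [1 - t] times that of the
    shortened code plus [t] times that of the punctured code. Their ratio is between 1 and 2 by
    [weight_enum_shift], so [chord_le_geometric_mean] applies. *)
Lemma weight_enum_le_expect t lam n (A : {set 'rV['F_2]_n}) : 0 < t -> t <= 1 ->
  0 < lam <= 1 -> expR (lam * ln 2) = 1 + t -> is_code A ->
  weight_enum t A <= expR (expect lam (log_card A)).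
Proof.
move=> t0 t1 lam01 lt; have [l0 l1] := andP lam01.
have t01 : 0 <= t <= 1 by rewrite ltW.
elim: n A => [|n IHn] A cA.
  have -> : A = [set 0]%SET.
    apply/setP => v; rewrite inE (_ : v = 0) ?eqxx ?(proj1 cA) //.
    by apply/rowP; case.
  rewrite /weight_enum big_set1 expect_row0 /log_card.
  rewrite (_ : hamming_weight 0 = 0%N); last first.
    by apply/eqP; rewrite -leqn0; exact: hamming_weight_le.
  rewrite (_ : #|_| = 1%N) ?ln1 ?expR0 //.
  apply/eqP/cards1P; exists 0; apply/setP => v; rewrite !inE.
  by case: eqP => // ->; rewrite covers0.
have cA0 := is_code_slice0 cA; have cU := is_code_sliceU cA.
rewrite expect_ccons.
have -> : expect lam (fun v => log_card A (ccons 0 v)) = expect lam (log_card (slice 0 A)).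
  by apply: eq_expect => v; rewrite /log_card card_subcode_ccons0.
have ih0 := IHn _ cA0; have ihU := IHn _ cU.
have W0 := weight_enum_gt0 (ltW t0) cA0.
rewrite weight_enum_slice.
case: (slice_cases cA) => [s1|s1|[dA [y s1]]].
- rewrite s1 weight_enum0 mulr0 add0r.
  rewrite (@eq_expect _ lam _ (fun v => log_card A (ccons 1 v)) (log_card (slice 0 A))).
    by rewrite -mulrDl subrKC mul1r.
  move=> v; rewrite /log_card card_subcode_ccons1 s1 (_ : #|subcode finset.set0 _| = 0%N) //.
  by apply: eq_card0 => c; rewrite !inE.
- rewrite s1 (@eq_expect _ lam _ (fun v => log_card A (ccons 1 v))
    (fun v => ln 2 + log_card (slice 0 A) v)); last first.
    move=> v; rewrite /log_card card_subcode_ccons1 s1 addnn -mul2n natrM lnM //.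
      by rewrite posrE.
    by rewrite posrE ltr0n; apply: card_code_gt0; apply: is_code_subcode.
  rewrite expectD expect_cst mulrDr -addrA -mulrDl subrKC mul1r expRD lt.
  by rewrite mulrDl mul1r addrC lerD // ler_wpM2l // ltW.
- rewrite (@eq_expect _ lam _ (fun v => log_card A (ccons 1 v))
    (log_card (slice 0 A :|: slice 1 A)%SET)); last first.
    move=> v; rewrite /log_card card_subcode_ccons1 addnC; congr (ln _%:R).
    rewrite -!sum1_card -bigU /=.
      by apply: eq_bigl => c; rewrite !inE andb_orl.
    apply/pred0P => c; rewrite !inE /=; apply/negP => /andP[/andP[c0 _] /andP[c1 _]].
    by have /pred0P/(_ c) := dA; rewrite /= !inE c0 c1.
  set W := weight_enum t (slice 0 A) in W0 ih0 *.
  have WU : weight_enum t (slice 0 A :|: slice 1 A)%SET = W + weight_enum t (slice 1 A).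
    exact: weight_enumU.
  have W1 : weight_enum t (slice 1 A) <= W by rewrite s1; apply: weight_enum_shift.
  have W1_ge0 : 0 <= weight_enum t (slice 1 A) by apply: weight_enum_ge0; rewrite ltW.
  rewrite (_ : _ + W = (1 - t) * W + t * weight_enum t (slice 0 A :|: slice 1 A)%SET); last first.
    by rewrite WU; ring.
  have le1 : W <= weight_enum t (slice 0 A :|: slice 1 A)%SET by rewrite WU lerDl.
  apply: le_trans (chord_le_geometric_mean t0 lam01 lt W0 le1 _) _.
    by rewrite WU; lra.
  rewrite ler_expR addrC lerD // ler_wpM2l ?subr_ge0 // ?(ltW l0) //.
    by rewrite -ler_expR lnK // posrE (lt_le_trans W0).
  by rewrite -ler_expR lnK // posrE.
Qed.

End WeightBound.

(** * Sharp threshold *)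

(** When [j] and the coordinates of [m] are erased, bit [j] of a word of the code [A] cannot be
    recovered. The probability is the EXIT function of coding theory. *)
Definition exit_event n (A : {set 'rV['F_2]_n}) (j : 'I_n) (m : 'rV['F_2]_n) : bool :=
  [exists c in A, (c 0 j != 0) && covers (upd m j 1) c].

Lemma upd_upd n (m : 'rV['F_2]_n) j x y : upd (upd m j x) j y = upd m j y.
Proof. by apply/rowP => k; rewrite !mxE; case: (k == j). Qed.

Lemma covers_upd0 n (m c : 'rV['F_2]_n) j :
  covers (upd m j 0) c = covers (upd m j 1) c && (c 0 j == 0).
Proof.
apply/forallP/andP => [h|[/forallP h cj] k].
  split; last by have := h j; rewrite mxE eqxx eqxx.
  by apply/forallP => k; have := h k; rewrite !mxE; case: ifP.
have := h k; rewrite !mxE; case: (k =P j) => // ->.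
by rewrite cj implybT.
Qed.

(** The words with [j]-th bit 1, if there are any, form a coset of those with [j]-th bit 0, so
    admitting [j] doubles the subcode or leaves it unchanged. *)
Lemma card_subcode_upd n (A : {set 'rV['F_2]_n}) j m : is_code A ->
  #|subcode A (upd m j 1)| = (#|subcode A (upd m j 0%R)| * 2 ^ exit_event A j m)%N.
Proof.
move=> cA; have s0 : subcode A (upd m j 0) = [set c in subcode A (upd m j 1) | c 0 j == 0]%SET.
  by apply/setP => c; rewrite !inE covers_upd0 andbA.
rewrite -(cardsID [set c : 'rV['F_2]_n | c 0 j == 0]%SET (subcode A (upd m j 1))).
have -> : subcode A (upd m j 1) :&: [set c : 'rV['F_2]_n | c 0 j == 0]%SET = subcode A (upd m j 0).
  by rewrite s0; apply/setP => c; rewrite !inE.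
case: (boolP (exit_event A j m)) => [/existsP[c0 /andP[c0A /andP[c0j mc0]]]|noexit].
  rewrite expn1 muln2 -addnn; congr (_ + _)%N.
  rewrite -[RHS](card_imset _ (@addIr _ c0)); apply: eq_card => c; rewrite !inE.
  have c0S : c0 \in subcode A (upd m j 1) by rewrite inE c0A.
  apply/idP/imsetP => [/and3P[cj cA' mc]|[c' + ->]].
    exists (c + c0); last by rewrite -addrA row2_addxx addr0.
    rewrite s0 inE code_addr ?c0S //; last exact: is_code_subcode.
    rewrite inE cA' mc mxE; move: cj c0j; rewrite !F2_neq0 => /eqP -> /eqP ->.
    by rewrite F2_addxx eqxx.
  rewrite s0 inE => /andP[c'S /eqP c'j].
  have := code_addr c' (is_code_subcode (upd m j 1) cA) c0S.
  by rewrite c'S inE mxE c'j add0r c0j.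
rewrite expn0 muln1 -[RHS]addn0; congr (_ + _)%N; apply: eq_card0 => c; rewrite !inE.
apply/negP => /and3P[cj cA' mc]; case/negP: noexit; apply/existsP; exists c.
by rewrite cA' cj mc.
Qed.

Lemma exit_event_mono n (A : {set 'rV['F_2]_n}) j k m :
  exit_event A j (upd m k 0) -> exit_event A j (upd m k 1).
Proof.
case/existsP => c /and3P[cA cj /forallP h]; apply/existsP; exists c; rewrite cA cj /=.
apply/forallP => i; have := h i; rewrite !mxE; case: (i == j) => //.
by case: (i == k); rewrite ?oner_eq0 // eqxx /= => ->; rewrite ?implybT.
Qed.

(** * Coordinate permutations *)

Section Permutations.
Variables (n : nat) (s : 'S_n).

Lemma col_perm_upd (m : 'rV['F_2]_n) i x :
  col_perm s (upd m (s i) x) = upd (col_perm s m) i x.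
Proof. by apply/rowP => k; rewrite !mxE (inj_eq perm_inj). Qed.

Lemma covers_col_perm (m c : 'rV['F_2]_n) :
  covers (col_perm s m) (col_perm s c) = covers m c.
Proof.
apply/forallP/forallP => h j; last by rewrite !mxE; apply: h.
by have := h (s^-1%g j); rewrite !mxE permKV.
Qed.

Lemma col_perm_inj (T : Type) (m : nat) : injective (@col_perm T m n s).
Proof.
move=> u v uv; apply/matrixP => i j.
have /matrixP/(_ i (s^-1%g j)) := uv.
by rewrite !mxE permKV.
Qed.

(** An injection of a finite set into itself is onto. *)
Lemma mem_col_perm (A : {set 'rV['F_2]_n}) :
  (forall v, v \in A -> col_perm s v \in A) ->
  forall v, (col_perm s v \in A) = (v \in A).
Proof.
move=> sA v; apply/idP/idP => [svA|/sA //].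
have im : (col_perm s @: A)%SET = A.
  apply/eqP; rewrite eqEcard card_imset ?leqnn ?andbT; last exact: col_perm_inj.
  by apply/fintype.subsetP => _ /imsetP[u uA ->]; apply: sA.
by move: svA; rewrite -{1}im mem_imset //; exact: col_perm_inj.
Qed.

Lemma exit_event_col_perm (A : {set 'rV['F_2]_n}) i m :
  (forall v, v \in A -> col_perm s v \in A) ->
  exit_event A i (col_perm s m) = exit_event A (s i) m.
Proof.
move=> sA; have sA' := mem_col_perm sA; apply/existsP/existsP => -[c].
  have -> : c = col_perm s (col_perm s^-1%g c).
    by apply/rowP => k; rewrite !mxE permK.
  move: (col_perm s^-1%g c) => {}c; rewrite sA' -col_perm_upd covers_col_perm mxE => h.
  by exists c.
move=> h; exists (col_perm s c).
by rewrite sA' -col_perm_upd covers_col_perm mxE.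
Qed.

Lemma hamming_weight_col_perm (v : 'rV['F_2]_n) :
  hamming_weight (col_perm s v) = hamming_weight v.
Proof.
rewrite !hamming_weightE [RHS](reindex_inj (@perm_inj _ s)) /=.
by apply: eq_bigr => i _; rewrite mxE.
Qed.

Lemma expect_col_perm (R : realType) (p : R) (f : 'rV['F_2]_n -> R) :
  expect p (fun v => f (col_perm s v)) = expect p f.
Proof.
rewrite [RHS]/expect (reindex_inj (@col_perm_inj _ 1)) /=; apply: eq_bigr => v _.
by rewrite /noise_mass hamming_weight_col_perm.
Qed.

End Permutations.

Definition doubly_transitive_set n (A : {set 'rV['F_2]_n}) : Prop :=
  forall i j k l : 'I_n, i != k -> j != l ->
  exists s : 'S_n, [/\ s i = j, s k = l & forall v, v \in A -> col_perm s v \in A].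

Section SharpThreshold.
Variable R : realType.

Definition exit_fun n (A : {set 'rV['F_2]_n}) (j : 'I_n) (m : 'rV['F_2]_n) : R :=
  (exit_event A j m)%:R.

Lemma diff_log_card n (A : {set 'rV['F_2]_n}) j m : is_code A ->
  bit_diff j (log_card R A) m = ln 2 * exit_fun A j m.
Proof.
move=> cA; rewrite /bit_diff /log_card card_subcode_upd // natrM lnM ?posrE ?ltr0n ?expn_gt0 //.
  rewrite addrC addKr /exit_fun; case: exit_event; rewrite ?mulr1 ?mulr0 //.
  by rewrite expn0 ln1.
by apply: card_code_gt0; apply: is_code_subcode.
Qed.

Lemma diff_exit01 n (A : {set 'rV['F_2]_n}) j k m :
  bit_diff k (exit_fun A j) m = 0 \/ bit_diff k (exit_fun A j) m = 1.
Proof.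
rewrite /bit_diff /exit_fun; have := @exit_event_mono n A j k m.
case: exit_event => [/(_ isT) ->|_]; first by left; rewrite subrr.
by case: exit_event; [right|left]; rewrite subr0.
Qed.

Lemma diff_exit_ge0 n (A : {set 'rV['F_2]_n}) j k m : 0 <= bit_diff k (exit_fun A j) m.
Proof. by case: (diff_exit01 A j k m) => ->. Qed.

Lemma diff_exit_self n (A : {set 'rV['F_2]_n}) j m : bit_diff j (exit_fun A j) m = 0.
Proof. by rewrite /bit_diff /exit_fun /exit_event !upd_upd subrr. Qed.

Lemma expect_exit_ge0 (p : R) n (A : {set 'rV['F_2]_n}) j :
  0 <= p <= 1 -> 0 <= expect p (exit_fun A j).
Proof. by move=> p01; apply: expect_ge0 => // z; rewrite ler0n. Qed.

Lemma expect_exit_le1 (p : R) n (A : {set 'rV['F_2]_n}) j :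
  0 <= p <= 1 -> expect p (exit_fun A j) <= 1.
Proof.
move=> p01; rewrite -[leRHS](@expect_cst R p n); apply: ler_expect => // z.
by rewrite lern1 leq_b1.
Qed.

(** Double transitivity moves pairs, so each index needs a companion; length [n.+2] provides one. *)
Lemma expect_exit_sym (p : R) n (A : {set 'rV['F_2]_n.+2}) i j :
  doubly_transitive_set A -> expect p (exit_fun A i) = expect p (exit_fun A j).
Proof.
move=> dtA; have ne (x : 'I_n.+2) : exists y, x != y.
  have [->|x0] := eqVneq x 0; first by exists 1.
  by exists 0.
have [k ik] := ne i; have [l jl] := ne j.
have [s [<- _ sA]] := dtA _ _ _ _ ik jl.
rewrite -(expect_col_perm s p (exit_fun A i)); apply: eq_expect => m.
by rewrite /exit_fun exit_event_col_perm.
Qed.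

Lemma expect_diff_exit_sym (p : R) n (A : {set 'rV['F_2]_n}) i j k l :
  doubly_transitive_set A -> i != k -> j != l ->
  expect p (bit_diff k (exit_fun A i)) = expect p (bit_diff l (exit_fun A j)).
Proof.
move=> dtA ik jl; have [s [<- <- sA]] := dtA _ _ _ _ ik jl.
rewrite -(expect_col_perm s p (bit_diff k _)); apply: eq_expect => m.
by rewrite /bit_diff /exit_fun -!col_perm_upd !exit_event_col_perm.
Qed.

(** Take [c = n.+1] in [falik_samorodnitsky]. The influence of [i] is 0 and, by double transitivity,
    the [n.+1] others share one value, so [c] times the sum of their squares is the squared total
    influence. By Russo's formula this is a differential inequality in [p]. *)
Lemma exit_influence_ge (p : R) n (A : {set 'rV['F_2]_n.+2}) i :
  0 <= p <= 1 -> doubly_transitive_set A ->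
  expect p (exit_fun A i) * (1 - expect p (exit_fun A i)) * ln n.+1%:R <=
  (\sum_k expect p (bit_diff k (exit_fun A i))) ^+ 2 +
  2 * \sum_k expect p (bit_diff k (exit_fun A i)).
Proof.
move=> p01 dtA; set h := expect p _; set I := \sum_k _.
have c0 : 0 < n.+1%:R :> R by rewrite ltr0n.
have := falik_samorodnitsky (exit_fun A i) p01 c0.
have -> : cube_variance p (exit_fun A i) = h * (1 - h).
  rewrite /cube_variance (@eq_expect _ p _ (fun z => exit_fun A i z ^+ 2) (exit_fun A i)).
    by rewrite -/h; ring.
  by move=> z; rewrite /exit_fun -natrX; case: exit_event.
have -> : \sum_k expect p (fun z => bit_diff k (exit_fun A i) z ^+ 2) = I.
  apply: eq_bigr => k _; apply: eq_expect => z.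
  by case: (diff_exit01 A i k z) => ->; rewrite ?expr0n ?expr1n.
have -> : \sum_k expect p (fun z => `|bit_diff k (exit_fun A i) z|) ^+ 2 =
    \sum_k expect p (bit_diff k (exit_fun A i)) ^+ 2.
  apply: eq_bigr => k _; congr (_ ^+ 2); apply: eq_expect => z.
  by rewrite ger0_norm // diff_exit_ge0.
have Ei : expect p (bit_diff i (exit_fun A i)) = 0.
  by rewrite (eq_expect _ (diff_exit_self A i)) expect_cst.
have [k0 ik0] : exists k, i != k.
  have [->|x0] := eqVneq i 0; first by exists 1.
  by exists 0.
pose q := expect p (bit_diff k0 (exit_fun A i)).
have Eq k : k != i -> expect p (bit_diff k (exit_fun A i)) = q.
  by rewrite eq_sym => ik; apply: expect_diff_exit_sym.
have card_ne : #|[pred k : 'I_n.+2 | k != i]| = n.+1.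
  by rewrite -[RHS]/(n.+2.-1) -[in RHS](card_ord n.+2) -(cardC1 i); apply: eq_card.
have IE : I = n.+1%:R * q.
  rewrite /I (bigD1 i) //= Ei add0r (eq_bigr _ Eq) sumr_const card_ne.
  by rewrite mulr_natl.
have -> : \sum_k expect p (bit_diff k (exit_fun A i)) ^+ 2 = n.+1%:R * q ^+ 2.
  rewrite (bigD1 i) //= Ei expr0n /= add0r.
  rewrite (eq_bigr (fun=> q ^+ 2)); last by move=> k /Eq ->.
  by rewrite sumr_const card_ne mulr_natl.
have -> : n.+1%:R * (n.+1%:R * q ^+ 2) = I ^+ 2 by rewrite IE; ring.
have hh : 0 <= h * (1 - h).
  by rewrite mulr_ge0 ?expect_exit_ge0 // subr_ge0 expect_exit_le1.
rewrite mulrDr mulr1; lra.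
Qed.

Lemma nondecreasing_of_derive (f df : R -> R) a b : a <= b ->
  (forall x, is_derive x (1 : R) f (df x)) ->
  (forall x, a <= x <= b -> 0 <= df x) -> f a <= f b.
Proof.
move=> ab fd df0.
have cf : {within `[a, b], continuous f}%classic.
  apply: continuous_subspaceT => x; apply: differentiable_continuous.
  by apply/derivable1_diffP; have [] := fd x.
have [c cab e] := MVT_segment ab (fun x _ => fd x) cf.
by rewrite -subr_ge0 e mulr_ge0 ?subr_ge0 // df0 // -in_itv /=.
Qed.

(* [1 - h <= 2 / r + h' / r] wherever [h >= 2 / r]; integrating this over [[u, 1]]
   bounds the integral of [h] over [[0, u]], because [h] has integral at most [1 - u] over
   [[0, 1]]. *)
Lemma expect_log_card_le n (A : {set 'rV['F_2]_n.+2}) (u r : R) :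
  is_code A -> doubly_transitive_set A -> 0 <= u <= 1 ->
  4 <= r -> r ^+ 4 <= ln n.+1%:R ->
  ln #|A|%:R <= (1 - u) * n.+2%:R * ln 2 ->
  expect u (log_card R A) <= 3 / r * n.+2%:R * ln 2.
Proof.
move=> cA dtA /andP[u0 u1] r4 rn dimA.
pose L : R := n.+2%:R * ln 2.
have ln2 : 0 < ln 2 :> R by rewrite ln_gt0 // ltr1n.
have L0 : 0 < L by rewrite mulr_gt0 // ltr0n.
pose phi (p : R) := expect p (log_card R A).
pose h (p : R) := expect p (exit_fun A 0).
pose h' (p : R) := \sum_k expect p (bit_diff k (exit_fun A 0)).
(* The area theorem; symmetry makes all EXIT functions equal. *)
have dphi p : is_derive p (1 : R) phi (L * h p).
  suff -> : L * h p = \sum_j expect p (bit_diff j (log_card R A)) by exact: russo.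
  rewrite (eq_bigr (fun=> ln 2 * h p)) => [|j _].
    by rewrite sumr_const card_ord -[RHS]mulr_natl /L mulrA.
  rewrite (eq_expect _ (fun m => diff_log_card j m cA)) expectZ; congr (_ * _).
  exact: expect_exit_sym.
have dh p : is_derive p (1 : R) h (h' p) by exact: russo.
have h'0 p : 0 <= p <= 1 -> 0 <= h' p.
  by move=> p01; apply: sumr_ge0 => k _; apply: expect_ge0 => // z; apply: diff_exit_ge0.
have hmono x y : 0 <= x -> x <= y -> y <= 1 -> h x <= h y.
  move=> x0 xy y1; apply: nondecreasing_of_derive xy dh _ => z /andP[xz zy].
  by apply: h'0; rewrite (le_trans x0 xz) (le_trans zy y1).
have r0 : 0 < r by lra.
have phi0 : phi 0 = 0.
  rewrite /phi /expect (bigD1 0) //= big1 ?addr0; last first.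
    move=> v v0; rewrite /noise_mass expr0n; case: eqP => [w0|_]; last by rewrite !mul0r.
    case/eqP: v0; apply/rowP => j; rewrite mxE; apply/eqP; apply: contraT => vj.
    have : (0 < hamming_weight v)%N by apply/card_gt0P; exists j; rewrite inE.
    by rewrite w0.
  rewrite /log_card (_ : #|_| = 1%N) ?ln1 ?mulr0 //.
  apply/eqP/cards1P; exists 0; apply/setP => c; rewrite !inE.
  apply/andP/eqP => [[_ /forallP c0]|->]; last by rewrite covers0 (proj1 cA).
  by apply/rowP => j; have := c0 j; rewrite !mxE eqxx => /eqP.
have phi1 : phi 1 <= (1 - u) * L.
  rewrite (le_trans _ (_ : ln #|A|%:R <= _)) //; last by rewrite /L mulrA.
  rewrite /phi -[leRHS](@expect_cst R 1 n.+2); apply: ler_expect; first by rewrite ler01 lexx.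
  move=> z; rewrite /log_card ler_ln ?posrE ?ltr0n ?card_code_gt0 //; last first.
    exact: is_code_subcode.
  by rewrite ler_nat subset_leq_card //; apply/fintype.subsetP => c; rewrite inE => /andP[].
suff : phi u <= 3 / r * L by rewrite /L mulrA.
have rV : 0 < r^-1 by rewrite invr_gt0.
(* If [h u <= 2 / r], then [h <= 2 / r] on [[0, u]] and integrating suffices; otherwise [h > 2 / r]
   on [[u, 1]]. *)
have [hu|hu] := leP (h u) (2 / r).
  have : 2 / r * L * 0 - phi 0 <= 2 / r * L * u - phi u.
    apply: (@nondecreasing_of_derive (fun x => (2 / r * L) * x - phi x)
      (fun x => 2 / r * L - L * h x) 0 u u0).
    move=> x.
    rewrite (_ : (fun _ => _) = fun y => 2 / r * L * y + (-1 * phi y + 0 * h y)); last first.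
      by apply/funext => y; rewrite mul0r addr0 mulN1r.
    apply: is_derive_eq (is_derive_lincomb _ _ _ (dphi x) (dh x)) _.
    by rewrite mul0r addr0 mulN1r.
    move=> x /andP[x0 xu]; rewrite [_ / r * L]mulrC -mulrBr mulr_ge0 ?(ltW L0) // subr_ge0.
    by apply: le_trans hu; apply: hmono.
  rewrite phi0 mulr0 subrr.
  have w0 : 0 <= r^-1 * L by rewrite mulr_ge0 // ltW.
  have : r^-1 * L * u <= r^-1 * L by rewrite -[leRHS]mulr1 ler_wpM2l.
  rewrite (_ : 2 / r * L * u = 2 * (r^-1 * L * u)); last by ring.
  rewrite (_ : 3 / r * L = 3 * (r^-1 * L)); last by ring.
  lra.
have : phi u + L * ((2 / r - 1) * u + r^-1 * h u) <=
    phi 1 + L * ((2 / r - 1) * 1 + r^-1 * h 1).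
  apply: (@nondecreasing_of_derive (fun x => phi x + L * ((2 / r - 1) * x + r^-1 * h x))
    (fun x => L * h x + L * ((2 / r - 1) + r^-1 * h' x)) u 1 u1).
    move=> x.
    rewrite (_ : (fun _ => _) =
        fun y => L * (2 / r - 1) * y + (1 * phi y + L * r^-1 * h y)); last first.
      by apply/funext => y; rewrite mul1r addrCA -[_ * y]mulrA -[_ * h y]mulrA -mulrDr.
    apply: is_derive_eq (is_derive_lincomb _ _ _ (dphi x) (dh x)) _.
    by rewrite mul1r addrCA -[L * r^-1 * _]mulrA -mulrDr.
  move=> x /andP[ux x1]; rewrite -mulrDr mulr_ge0 ?(ltW L0) //.
  have x01 : 0 <= x <= 1 by rewrite (le_trans u0 ux).
  have hx : 2 / r <= h x by apply: ltW; apply: lt_le_trans hu _; apply: hmono.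
  have hx1 : h x <= 1 by apply: expect_exit_le1.
  have h'x := h'0 _ x01.
  have rh' : 0 <= r^-1 * h' x by rewrite mulr_ge0 // ltW.
  have [big|small] := leP (1 - h x) (2 / r); first lra.
  (* Here [h (1 - h) >= 1 / r] and the logarithm is at least [r^4], so the left side of the
     influence inequality is at least [r^3 >= 4 r^2]. With [h' x < r] the right side would be below
     [r^2 + 2 r], which is smaller as [r >= 4]. *)
  have : r <= h' x.
    rewrite leNgt; apply/negP => lt_r.
    have := exit_influence_ge 0 x01 dtA; rewrite -/(h x) -/(h' x) /=.
    have i1 : 1 / r <= h x * (1 - h x).
      have rlt : r^-1 <= 4^-1 by rewrite lef_pV2 ?posrE //.
      have [hs|hb] := leP (h x) (1 / 2).
        have : 2 / r * (1 / 2) <= h x * (1 - h x).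
          by apply: ler_pM => //; lra.
        by lra.
      have : (1 / 2) * (2 / r) <= h x * (1 - h x).
        by apply: ler_pM => //; lra.
      by lra.
    have : 1 / r * r ^+ 4 <= h x * (1 - h x) * ln n.+1%:R.
      by apply: ler_pM => //; [rewrite mul1r ltW | rewrite exprn_ge0 // ltW].
    rewrite (_ : 1 / r * r ^+ 4 = r ^+ 3); last by field; rewrite gt_eqF.
    move: (h' x) h'x lt_r => y y0 yr.
    have : y ^+ 2 <= r ^+ 2 by rewrite ler_sqr ?nnegrE // ltW.
    have : 4 * r ^+ 2 <= r ^+ 3 by rewrite [r ^+ 3]exprS ler_wpM2r ?sqr_ge0.
    have : 4 * r <= r ^+ 2 by rewrite expr2 ler_wpM2r // ltW.
    lra.
  move=> /(ler_wpM2l (ltW rV)); rewrite mulVf ?gt_eqF //; lra.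
(* The bound [(1 - u) L] on [phi 1] cancels against the linear part, leaving at most
   [2 L / r + L / r]. *)
rewrite mulr1.
have h1 : h 1 <= 1 by apply: expect_exit_le1; rewrite ler01 lexx.
have hu0 : 0 <= h u by apply: expect_exit_ge0; rewrite u0.
have i1 : L * (r^-1 * h 1) <= L * r^-1.
  by rewrite ler_wpM2l ?(ltW L0) // -[leRHS]mulr1 ler_wpM2l // ltW.
have i2 : 0 <= L * (r^-1 * h u) by rewrite !mulr_ge0 // ltW.
have i3 : 0 <= L * r^-1 * u by rewrite !mulr_ge0 // ltW.
rewrite (_ : L * (_ + r^-1 * h u) = 2 * (L * r^-1 * u) - L * u + L * (r^-1 * h u)); last by ring.
rewrite (_ : L * (_ + r^-1 * h 1) = 2 * (L * r^-1) - L + L * (r^-1 * h 1)); last by ring.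
rewrite (_ : 3 / r * L = 3 * (L * r^-1)); last by ring.
move: phi1; rewrite mulrBl mul1r [u * L]mulrC.
set a := L * r^-1 in i1 i3 *; set b := L * (_ * h 1) in i1 *.
set c := L * (_ * h u) in i2 *; set d := a * u in i3 *; set e := L * u.
lra.
Qed.

End SharpThreshold.

(** * Fourier analysis on the dual code *)

Definition dotp n (u v : 'rV['F_2]_n) : 'F_2 := \sum_i u 0 i * v 0 i.

Lemma dotC n (u v : 'rV['F_2]_n) : dotp u v = dotp v u.
Proof. by apply: eq_bigr => i _; rewrite mulrC. Qed.

Lemma dotDr n (u v w : 'rV['F_2]_n) : dotp u (v + w) = dotp u v + dotp u w.
Proof. by rewrite /dotp -big_split; apply: eq_bigr => i _; rewrite mxE mulrDr. Qed.

Lemma dot0r n (u : 'rV['F_2]_n) : dotp u 0 = 0.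
Proof. by rewrite /dotp big1 // => i _; rewrite mxE mulr0. Qed.

Lemma dot_ccons n x y (u v : 'rV['F_2]_n) :
  dotp (ccons x u) (ccons y v) = x * y + dotp u v.
Proof.
rewrite /dotp big_ord_recl !ccons0E; congr (_ + _).
by apply: eq_bigr => i _; rewrite !cconsSE.
Qed.

Lemma dot_col_perm n (s : 'S_n) (u v : 'rV['F_2]_n) :
  dotp (col_perm s u) (col_perm s v) = dotp u v.
Proof.
rewrite [RHS]/dotp (reindex_inj (@perm_inj _ s)) /=.
by apply: eq_bigr => i _; rewrite !mxE.
Qed.

Definition dual_code n (A : {set 'rV['F_2]_n}) : {set 'rV['F_2]_n} :=
  [set d | [forall c in A, dotp d c == 0]]%SET.

Lemma is_code_dual n (A : {set 'rV['F_2]_n}) : is_code (dual_code A).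
Proof.
split; first by rewrite inE; apply/forall_inP => c _; rewrite dotC dot0r.
move=> u v; rewrite !inE => /forall_inP hu /forall_inP hv; apply/forall_inP => c cA.
by rewrite dotC dotDr dotC (eqP (hu c cA)) dotC (eqP (hv c cA)) addr0.
Qed.

Lemma doubly_transitive_dual n (A : {set 'rV['F_2]_n}) :
  doubly_transitive_set A -> doubly_transitive_set (dual_code A).
Proof.
move=> dtA i j k l ik jl; have [s [si sk sA]] := dtA _ _ _ _ ik jl.
exists s; split=> // d; rewrite !inE => /forall_inP hd; apply/forall_inP => c cA.
have -> : c = col_perm s (col_perm s^-1%g c).
  by apply/rowP => q; rewrite !mxE permK.
rewrite dot_col_perm; apply: hd; rewrite -(mem_col_perm sA).
by rewrite (_ : col_perm s _ = c) //; apply/rowP => q; rewrite !mxE permK.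
Qed.

Section Characters.
Variable R : realType.

Definition chi n (d x : 'rV['F_2]_n) : R := if dotp d x == 0 then 1 else -1.

Lemma chiC n (d x : 'rV['F_2]_n) : chi d x = chi x d.
Proof. by rewrite /chi dotC. Qed.

Lemma chiD n (d x y : 'rV['F_2]_n) : chi d (x + y) = chi d x * chi d y.
Proof.
rewrite /chi dotDr.
case/orP: (F2_cases (dotp d x)) => /eqP ->; case/orP: (F2_cases (dotp d y)) => /eqP ->;
  by rewrite ?F2_addxx ?addr0 ?add0r ?eqxx ?oner_eq0 ?mulrNN ?mul1r ?mulr1.
Qed.

Lemma chi0 n (d : 'rV['F_2]_n) : chi d 0 = 1.
Proof. by rewrite /chi dot0r eqxx. Qed.

(** Translating by a word [c0] of [A] with [dotp d c0 = 1] negates the sum, so it vanishes. *)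
Lemma sum_chi_code n (A : {set 'rV['F_2]_n}) d : is_code A ->
  \sum_(c in A) chi d c = #|A|%:R *+ (d \in dual_code A).
Proof.
move=> cA; rewrite inE; case: forall_inP => [dA|/forall_inP].
  rewrite (eq_bigr (fun=> 1)) => [|c /dA]; last by rewrite /chi => ->.
  by rewrite sumr_const.
rewrite negb_forall_in => /exists_inP[c0 c0A dc0].
have : \sum_(c in A) chi d c = - \sum_(c in A) chi d c.
  rewrite {1}(reindex_inj (addIr c0)) /= -sumrN.
  apply: eq_big => [c|c _]; first exact: code_addr.
  by rewrite chiD {2}/chi (negPf dc0) mulrN1.
by move/eqP; rewrite -addr_eq0 -mulr2n mulrn_eq0 /= => /eqP ->.
Qed.

Lemma sum_chi n (x : 'rV['F_2]_n) : \sum_d chi d x = (2 ^ n)%:R *+ (x == 0).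
Proof.
have cT : is_code ([set: 'rV['F_2]_n])%SET by split=> [|u v]; rewrite !inE.
rewrite (eq_bigr (chi x)) => [|d _]; last exact: chiC.
have -> : \sum_d chi x d = \sum_(d in [set: 'rV['F_2]_n]%SET) chi x d.
  by apply: eq_bigl => d; rewrite inE.
rewrite sum_chi_code // cardsT card_mx card_Fp // mul1n; congr (_ *+ nat_of_bool _).
rewrite inE; apply/forall_inP/eqP => [h|-> c _]; last by rewrite dotC dot0r.
apply/rowP => i; have := h (delta_mx 0 i) (finset.in_setT _).
rewrite /dotp (bigD1 i) //= big1 => [|k ki]; last by rewrite mxE (negPf ki) andbF mulr0.
by rewrite !mxE !eqxx mulr1 addr0 => /eqP.
Qed.

(** Write the indicator of the dual as a character sum over [C], exchange the sums and use
    orthogonality on the whole space. *)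
Lemma poisson_summation n (C : {set 'rV['F_2]_n}) x : is_code C ->
  #|C|%:R * \sum_(d in dual_code C) chi d x = (2 ^ n)%:R *+ (x \in C).
Proof.
move=> cC; rewrite mulr_sumr big_mkcond /=.
rewrite (eq_bigr (fun d => \sum_(c in C) chi d (x + c))); last first.
  move=> d _; rewrite (eq_bigr (fun c => chi d x * chi d c)); last by move=> c _; apply: chiD.
  by rewrite -mulr_sumr sum_chi_code //; case: ifP; rewrite ?mulr0 // mulrC.
rewrite exchange_big /= (eq_bigr (fun c => (2 ^ n)%:R *+ (c == x))); last first.
  by move=> c _; rewrite sum_chi addr_eq0 row2_oppx eq_sym.
rewrite big_mkcond /= (bigD1 x) //= eqxx big1 ?addr0; first by case: (x \in C).
by move=> c /negPf ->; case: ifP.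
Qed.

Lemma card_dual n (C : {set 'rV['F_2]_n}) : is_code C -> (#|C| * #|dual_code C| = 2 ^ n)%N.
Proof.
move=> cC; apply/eqP; rewrite -(eqr_nat R) natrM.
have := poisson_summation 0 cC; rewrite (proj1 cC) mulr1n => <-.
by rewrite (eq_bigr (fun=> 1)) ?sumr_const // => d _; apply: chi0.
Qed.

(** Expanding the square produces [chi d (y + z)]; Poisson summation turns its sum over the dual
    into the condition [y + z \in C]. *)
Lemma parseval_code n (C : {set 'rV['F_2]_n}) (g : 'rV['F_2]_n -> R) : is_code C ->
  (2 ^ n)%:R * \sum_y \sum_(z | y + z \in C) g y * g z =
  #|C|%:R * \sum_(d in dual_code C) (\sum_y g y * chi d y) ^+ 2.
Proof.
move=> cC.
have -> : \sum_(d in dual_code C) (\sum_y g y * chi d y) ^+ 2 =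
    \sum_y \sum_z g y * g z * \sum_(d in dual_code C) chi d (y + z).
  rewrite (eq_bigr (fun d => \sum_y \sum_z g y * g z * chi d (y + z))); last first.
    move=> d _; rewrite expr2 mulr_suml; apply: eq_bigr => y _.
    by rewrite mulr_sumr; apply: eq_bigr => z _; rewrite chiD; ring.
  rewrite exchange_big; apply: eq_bigr => y _; rewrite exchange_big.
  by apply: eq_bigr => z _; rewrite mulr_sumr.
rewrite !mulr_sumr; apply: eq_bigr => y _; rewrite !mulr_sumr big_mkcond.
apply: eq_bigr => z _; rewrite [RHS]mulrCA poisson_summation // [RHS]mulrC.
by case: (y + z \in C); rewrite ?mulr1n ?mulr0n ?mulr0 ?mul0r.
Qed.

End Characters.

(** * Fourier coefficients of functions of the weight *)

Section Krawtchouk.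
Variables (R : realType) (p : R).
Hypothesis p01 : 0 <= p <= 1.

(** Averages out one noise bit, [g] being a function of the weight: this operator for a coordinate
    where [d] is 1, [op_plus] for one where [d] is 0. *)
Definition op_minus (g : nat -> R) (s : nat) : R := (1 - p) * g s - p * g s.+1.
Definition op_plus (g : nat -> R) (s : nat) : R := (1 - p) * g s + p * g s.+1.

Lemma op_comm g : op_plus (op_minus g) = op_minus (op_plus g).
Proof. by apply/funext => s; rewrite /op_plus /op_minus; ring. Qed.

Lemma op_plus_iter w g : op_plus (iter w op_minus g) = iter w op_minus (op_plus g).
Proof. by elim: w => //= w <-; rewrite op_comm. Qed.

Lemma op_minus_iter w g : op_minus (iter w op_plus g) = iter w op_plus (op_minus g).
Proof. by elim: w => //= w <-; rewrite op_comm. Qed.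

(** The offset [s] holds the weight already read, as the induction demands. The operators commute,
    so only their multiplicities matter. *)
Lemma expect_chi n (d : 'rV['F_2]_n) g s :
  expect p (fun y => g (s + hamming_weight y)%N * chi R d y) =
  iter (hamming_weight d) op_minus (iter (n - hamming_weight d) op_plus g) s.
Proof.
elim: n d s => [|n IHn] d s.
  have w0 (v : 'rV['F_2]_0) : hamming_weight v = 0%N.
    by apply/eqP; rewrite -leqn0; exact: hamming_weight_le.
  by rewrite expect_row0 chi0 mulr1 !w0 addn0.
rewrite -(ccons_tail d); move: (d 0 ord0) (ctail d) => x {}d.
rewrite expect_ccons hamming_weight_ccons.
have e0 : expect p (fun v => g (s + hamming_weight (ccons 0%R v))%N *
      chi R (ccons x d) (ccons 0 v)) =
    expect p (fun v => g (s + hamming_weight v)%N * chi R d v).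
  by apply: eq_expect => v; rewrite hamming_weight_ccons eqxx add0n /chi dot_ccons mulr0 add0r.
have e1 : expect p (fun v => g (s + hamming_weight (ccons 1%R v))%N *
      chi R (ccons x d) (ccons 1 v)) =
    (if x == 0 then 1 else -1) * expect p (fun v => g (s.+1 + hamming_weight v)%N * chi R d v).
  rewrite -expectZ; apply: eq_expect => v.
  rewrite hamming_weight_ccons oner_eq0 add1n addSnnS mulrCA; congr (_ * _).
  rewrite /chi dot_ccons mulr1; case/orP: (F2_cases x) => /eqP ->.
    by rewrite add0r eqxx mul1r.
  rewrite oner_eq0; case/orP: (F2_cases (dotp d v)) => /eqP ->.
    by rewrite addr0 oner_eq0 eqxx mulr1.
  by rewrite F2_addxx eqxx oner_eq0 mulrNN mulr1.
rewrite e0 e1 !IHn; set F := iter _ op_minus _.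
case/orP: (F2_cases x) => /eqP ->.
  rewrite eqxx add0n subSn ?hamming_weight_le //= -op_plus_iter -/F /op_plus; ring.
by rewrite oner_eq0 add1n subSS /= -/F /op_minus; ring.
Qed.

Lemma op_minus_bound g M : (forall s, `|g s| <= M) -> forall s, `|op_minus g s| <= M.
Proof.
case/andP: p01 => p0 p1 gM s; have q0 : 0 <= 1 - p by rewrite subr_ge0.
apply: le_trans (ler_normB _ _) _; rewrite !normrM (ger0_norm p0) (ger0_norm q0).
have := ler_wpM2l p0 (gM s.+1); have := ler_wpM2l q0 (gM s); lra.
Qed.

Lemma op_plus_bound g M : (forall s, `|g s| <= M) -> forall s, `|op_plus g s| <= M.
Proof.
case/andP: p01 => p0 p1 gM s; have q0 : 0 <= 1 - p by rewrite subr_ge0.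
apply: le_trans (ler_normD _ _) _; rewrite !normrM (ger0_norm p0) (ger0_norm q0).
have := ler_wpM2l p0 (gM s.+1); have := ler_wpM2l q0 (gM s); lra.
Qed.

(** The terms in [g s.+1] cancel. The factor left is the probability that two noise bits agree. *)
Lemma op_minus_plus_bound g M : (forall s, `|g s| <= M) ->
  forall s, `|op_minus (op_plus g) s| <= (p ^+ 2 + (1 - p) ^+ 2) * M.
Proof.
move=> gM s.
rewrite (_ : op_minus _ s = (1 - p) ^+ 2 * g s - p ^+ 2 * g s.+2); last first.
  by rewrite /op_minus /op_plus; ring.
apply: le_trans (ler_normB _ _) _.
rewrite (normrM ((1 - p) ^+ 2)) (normrM (p ^+ 2)) !(ger0_norm (sqr_ge0 _)).
have := ler_wpM2l (sqr_ge0 p) (gM s.+2); have := ler_wpM2l (sqr_ge0 (1 - p)) (gM s).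
rewrite mulrDl; lra.
Qed.

Lemma op_iter_bound w v g M : (forall s, `|g s| <= M) ->
  forall s, `|iter w op_minus (iter v op_plus g) s| <=
    (p ^+ 2 + (1 - p) ^+ 2) ^+ minn w v * M.
Proof.
have iterP v' : forall f L, (forall s, `|f s| <= L) -> forall s, `|iter v' op_plus f s| <= L.
  by elim: v' => //= v' IH f L fL; apply: op_plus_bound; apply: IH.
have iterM w' : forall f L, (forall s, `|f s| <= L) -> forall s, `|iter w' op_minus f s| <= L.
  by elim: w' => //= w' IH f L fL; apply: op_minus_bound; apply: IH.
elim: w v g M => [|w IHw] v g M gM s.
  by rewrite min0n expr0 mul1r; apply: iterP.
case: v => [|v]; first by rewrite minn0 expr0 mul1r; apply: iterM.
rewrite iterSr iterSr op_minus_iter minnSS exprSr -mulrA.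
by apply: IHw; apply: op_minus_plus_bound.
Qed.

(* Pairing a coordinate where [d] is 1 with one where [d] is 0, the sum vanishes unless
   the two noise bits agree. *)
Lemma expect_chi_bound n (d : 'rV['F_2]_n) g : (forall s, `|g s| <= 1) ->
  `|expect p (fun y => g (hamming_weight y) * chi R d y)| <=
  (p ^+ 2 + (1 - p) ^+ 2) ^+ minn (hamming_weight d) (n - hamming_weight d).
Proof.
move=> g1; have -> : expect p (fun y => g (hamming_weight y) * chi R d y) =
    iter (hamming_weight d) op_minus (iter (n - hamming_weight d) op_plus g) 0.
  by rewrite -expect_chi.
by rewrite -[leRHS]mulr1; apply: op_iter_bound.
Qed.

Lemma hamming_weight_compl n (v : 'rV['F_2]_n) :
  hamming_weight (v + const_mx 1) = (n - hamming_weight v)%N.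
Proof.
rewrite /hamming_weight; set S := [set i | v 0 i != 0]%SET.
have cS : (#|S| + #|~: S| = n)%N by rewrite cardsC card_ord.
rewrite (_ : [set i | _]%SET = ~: S)%SET; first by lia.
apply/setP => i; rewrite !inE !mxE negbK F2_neq0.
case/orP: (F2_cases (v 0 i)) => /eqP ->; first by rewrite add0r !eqxx.
by rewrite F2_addxx eq_sym oner_eq0.
Qed.

(** Bound [t] to the smaller of [k] and [n - k] by [t^k + t^(n - k)]. The second summand gives the
    enumerator of [D] shifted by the all-ones vector, which [weight_enum_shift] controls. *)
Lemma sum_sqr_expect_chi n (D : {set 'rV['F_2]_n}) g t : is_code D ->
  (forall s, `|g s| <= 1) -> 0 <= t <= 1 -> (p ^+ 2 + (1 - p) ^+ 2) ^+ 2 <= t ->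
  \sum_(d in D) expect p (fun y => g (hamming_weight y) * chi R d y) ^+ 2 <=
  2 * weight_enum t D.
Proof.
move=> cD g1 /andP[t0 t1] at_; pose a := p ^+ 2 + (1 - p) ^+ 2.
have a0 : 0 <= a by rewrite addr_ge0 // sqr_ge0.
have compl : \sum_(d in D) t ^+ (n - hamming_weight d) <= weight_enum t D.
  apply: le_trans (weight_enum_shift (const_mx 1) _ cD); last by rewrite t0.
  rewrite /weight_enum [leRHS](reindex_inj (addIr (const_mx 1))) /= le_eqVlt.
  apply/orP; left; apply/eqP; apply: eq_big => [d|d _].
    by rewrite inE -addrA row2_addxx addr0.
  by rewrite hamming_weight_compl.
have : \sum_(d in D) expect p (fun y => g (hamming_weight y) * chi R d y) ^+ 2 <=
    \sum_(d in D) (t ^+ hamming_weight d + t ^+ (n - hamming_weight d)).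
  apply: ler_sum => d _; rewrite -real_normK ?num_real //.
  have := expect_chi_bound d g1; rewrite -/a; set X := `|_|; set k := minn _ _ => XA.
  have : X ^+ 2 <= t ^+ k.
    apply: (@le_trans _ _ ((a ^+ 2) ^+ k)); last by rewrite lerXn2r ?nnegrE ?sqr_ge0.
    by rewrite exprAC; apply: lerXn2r; rewrite ?nnegrE ?exprn_ge0 ?normr_ge0.
  move=> /le_trans; apply; rewrite /k; case: leqP => _.
    by rewrite lerDl exprn_ge0.
  by rewrite lerDr exprn_ge0.
move=> /le_trans; apply; rewrite big_split /= mulrDl mul1r.
by rewrite lerD.
Qed.

End Krawtchouk.

(** The difference [f] of the logarithms vanishes at 0 and 1 and has nonincreasing derivative
    between them, so it increases up to [x] or decreases from [x] on. *)
Lemma one_add_sqr_le (R : realType) (x : R) : 0 <= x <= 1 -> 1 + x ^+ 2 <= expR (x * ln 2).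
Proof.
move=> /andP[x0 x1].
pose f (y : R) := y * ln 2 - ln (1 + y ^+ 2).
pose df (y : R) := ln 2 - 2 * y / (1 + y ^+ 2).
have pos (y : R) : 0 < 1 + y ^+ 2 by rewrite ltr_pwDl // sqr_ge0.
have dlin (y : R) : is_derive y (1 : R) (fun z : R => 1 + z ^+ 2) (2 * y).
  rewrite (_ : (fun z => _) = cst 1 + id ^+ 2); last exact/funext.
  by apply: is_derive_eq; rewrite /GRing.scale /= add0r expr1 mulr1 mulr_natl.
have fd y : is_derive y (1 : R) f (df y).
  rewrite (_ : f = ln 2 *: id - (@ln R \o (fun z : R => 1 + z ^+ 2))); last first.
    by apply/funext => z; rewrite /f /= !fctE /GRing.scale /= mulrC.
  have dl := is_derive1_ln (pos y).
  have dc := @is_derive1_comp _ (@ln R) (fun z : R => 1 + z ^+ 2) y _ _ dl (dlin y).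
  apply: is_derive_eq (is_deriveB (is_deriveZ (ln 2) (is_derive_id y (1 : R))) dc) _.
  by rewrite /df /GRing.scale /= mulr1 [_^-1 * _]mulrC.
have dfmono y z : 0 <= y -> y <= z -> z <= 1 -> df z <= df y.
  move=> y0 yz z1; rewrite /df lerD2l lerN2 ler_pdivlMr // mulrAC ler_pdivrMr //.
  have : 0 <= (z - y) * (1 - z * y).
    rewrite mulr_ge0 ?subr_ge0 // -[leRHS](mulr1 1) ler_pM //; first exact: le_trans yz.
    exact: le_trans z1.
  nra.
have f0 : f 0 = 0 by rewrite /f mul0r expr0n /= addr0 ln1 subrr.
have f1 : f 1 = 0 by rewrite /f mul1r expr1n subrr.
have fx : 0 <= f x.
  have [dx|dx] := leP 0 (df x).
    rewrite -f0; apply: (nondecreasing_of_derive x0 fd) => y /andP[y0 yx].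
    by apply: le_trans dx _; apply: dfmono.
  rewrite -oppr_le0 -[leRHS]oppr0 -f1.
  apply: (@nondecreasing_of_derive _ (- f) (- df) _ _ x1) => y.
  case/andP=> xy y1; rewrite fctE oppr_ge0; apply: le_trans (ltW dx).
  by apply: dfmono.
by rewrite -[leLHS]lnK ?posrE // ler_expR -subr_ge0.
Qed.

(** * List decoding *)

Section NoiseProbability.
Variables (R : realType) (p : R).
Hypothesis p01 : 0 <= p <= 1.

Lemma noise_prob_le_expect n (A : {set 'rV['F_2]_n}) (f : 'rV['F_2]_n -> R) :
  (forall z, 0 <= f z) -> (forall z, z \in A -> 1 <= f z) ->
  noise_prob p A <= expect p f.
Proof.
move=> f0 f1; rewrite /noise_prob big_mkcond; apply: ler_sum => z _.
case: ifP => [/f1 fz|_]; last by rewrite mulr_ge0 ?noise_mass_ge0.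
by rewrite -[leLHS]mulr1 ler_wpM2l ?noise_mass_ge0.
Qed.

Lemma variance_hamming_weight n :
  expect p (fun z : 'rV['F_2]_n => ((hamming_weight z)%:R - p * n%:R) ^+ 2) =
  n%:R * (p * (1 - p)).
Proof.
elim: n => [|n IHn].
  rewrite expect_row0 (_ : hamming_weight 0 = 0%N) ?mulr0 ?subrr ?expr0n ?mul0r //.
  by apply/eqP; rewrite -leqn0; exact: hamming_weight_le.
rewrite expect_ccons -!expectZ -expectD -[n.+1%:R]natr1 mulrDl -IHn mul1r.
rewrite -[X in _ = _ + X](@expect_cst R p n) -expectD; apply: eq_expect => v.
rewrite !hamming_weight_ccons oner_eq0 eqxx add0n add1n -[(_.+1)%:R]natr1; ring.
Qed.

End NoiseProbability.

Section ListSize.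
Variables (R : realType) (p : R).
Hypothesis p01 : 0 <= p <= 1.

Definition near_codewords n (C : {set 'rV['F_2]_n}) (B : R) (x : 'rV['F_2]_n) :
    {set 'rV['F_2]_n} :=
  [set c in C | (hamming_weight (c + x))%:R <= B]%SET.

Lemma card_near_codewords_shift n (C : {set 'rV['F_2]_n}) B c x : is_code C -> c \in C ->
  #|near_codewords C B (c + x)| = #|near_codewords C B x|.
Proof.
move=> cC cin; rewrite -[LHS](card_imset _ (addIr c)); apply: eq_card => v.
rewrite inE; apply/imsetP/idP => [[u + ->]|/andP[vC vB]].
  by rewrite inE addrA => /andP[uC uB]; rewrite code_addr // uC.
exists (v + c); last by rewrite -addrA row2_addxx addr0.
by rewrite inE code_addr // vC addrA -(addrA v) row2_addxx addr0.
Qed.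

(* Both the noise and the error pattern of a competing codeword have weight at most [B],
   so the expected number of competitors is a quadratic form in [P_eps] restricted to
   weight at most [B]; [parseval_code] evaluates it on the dual code. *)
Lemma expect_card_near_codewords n (C : {set 'rV['F_2]_n}) (B Q t : R) : is_code C ->
  0 <= Q -> 0 <= t <= 1 -> (p ^+ 2 + (1 - p) ^+ 2) ^+ 2 <= t ->
  (forall z : 'rV['F_2]_n, (hamming_weight z)%:R <= B -> 1 <= Q * noise_mass p z) ->
  (2 ^ n)%:R * expect p (fun z => ((hamming_weight z)%:R <= B)%R%:R *
    #|near_codewords C B z|%:R) <=
  Q * #|C|%:R * (2 * weight_enum t (dual_code C)).
Proof.
move=> cC Q0 t01 at_ Qmass.
pose g (s : nat) : R := (s%:R <= B)%R%:R.
have g1 s : `|g s| <= 1 by rewrite /g ger0_norm ?ler0n // lern1 leq_b1.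
pose G (z : 'rV['F_2]_n) := noise_mass p z * g (hamming_weight z).
have G0 z : 0 <= G z by rewrite mulr_ge0 ?noise_mass_ge0 ?ler0n.
have := @sum_sqr_expect_chi R p p01 n (dual_code C) g t (is_code_dual C) g1 t01 at_.
have := parseval_code G cC.
have -> : \sum_(d in dual_code C) (\sum_y G y * chi R d y) ^+ 2 =
    \sum_(d in dual_code C) expect p (fun y => g (hamming_weight y) * chi R d y) ^+ 2.
  by apply: eq_bigr => d _; congr (_ ^+ 2); apply: eq_bigr => y _; rewrite mulrA.
move=> parseval bound.
have pos : 0 <= Q * #|C|%:R by rewrite mulr_ge0.
apply: le_trans (ler_wpM2l pos bound); rewrite -mulrA -parseval mulrCA ler_wpM2l //.
rewrite mulr_sumr; apply: ler_sum => y _; rewrite mulrA -/(g _) -/(G _).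
(* Competitors are indexed by their error patterns [z]; as these have weight at most [B], [Qmass]
   supplies the missing noise mass. *)
rewrite -sum1_card natr_sum (reindex_inj (addIr y)) /= mulr_sumr big_mkcond mulr_sumr.
rewrite [leRHS]big_mkcond; apply: ler_sum => z _.
rewrite inE -addrA row2_addxx addr0 [z + y]addrC.
case: (y + z \in C) => //=; case: ifP => zB; last by apply: mulr_ge0 => //; apply: mulr_ge0.
rewrite mulrCA ler_wpM2l // /G /g zB mulr1.
by apply: Qmass.
Qed.

(** At weight [p n] the mass is 2 to the power minus entropy times [n]; each further unit of weight
    costs a factor [(1 - p) / p >= 1]. *)
Lemma noise_mass_ge n (z : 'rV['F_2]_n) (Delta : R) : 0 < p -> p < 1 / 2 ->
  (hamming_weight z)%:R <= p * n%:R + Delta ->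
  1 <= expR (ln 2 * binary_entropy p * n%:R + Delta * ln ((1 - p) / p)) * noise_mass p z.
Proof.
move=> p0 p2 wz; have q0 : 0 < 1 - p by lra.
have ln2 : ln 2 != 0 :> R by rewrite gt_eqF // ln_gt0 // ltr1n.
have wn := hamming_weight_le z.
have -> : noise_mass p z =
    expR ((hamming_weight z)%:R * ln p + (n%:R - (hamming_weight z)%:R) * ln (1 - p)).
  rewrite expRD -natrB // !expRM_natl.
  by rewrite !lnK ?posrE.
rewrite -expRD -[leLHS]expR0 ler_expR /binary_entropy /log2 !div1r.
rewrite !lnV ?posrE // ln_div ?posrE //.
have k0 : 0 <= ln (1 - p) - ln p by rewrite subr_ge0 ler_ln ?posrE //; lra.
have := ler_wpM2r k0 wz.
rewrite (_ : ln 2 * _ = - (p * ln p + (1 - p) * ln (1 - p))); last by field.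
set a := ln p; set b := ln (1 - p); set w := _%:R; set N := n%:R => h.
rewrite -subr_ge0 in h; apply: le_trans h _; rewrite le_eqVlt; apply/orP; left; apply/eqP; ring.
Qed.

End ListSize.

Lemma card_vspace_F2 n (C : {vspace 'rV['F_2]_n}) : #|[set c in C]%SET| = (2 ^ \dim C)%N.
Proof.
rewrite cardsE; have := @card_vspace 'F_2 'rV['F_2]_n _ C.
by rewrite card_Fp // => <-.
Qed.

Section GrowthRates.
Variable R : realType.

(** The largest [r] that [expect_log_card_le] admits at length [N = n.+2]. *)
Definition sharpness (N : nat) : R := Num.sqrt (Num.sqrt (ln N.-1%:R)).
Definition fourth_root (N : nat) : R := Num.sqrt (Num.sqrt N%:R).

Lemma sqrt_sqrt_exp4 (x : R) : 0 <= x -> Num.sqrt (Num.sqrt x) ^+ 4 = x.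
Proof. by move=> x0; rewrite (exprM _ 2 2) !sqr_sqrtr ?sqrtr_ge0. Qed.

Lemma near_fourth_root (M : R) : \forall N \near \oo%classic, M <= fourth_root N.
Proof.
near=> N; have : M ^+ 4 <= N%:R by near: N; exact: nbhs_infty_ger.
rewrite -{1}(sqrt_sqrt_exp4 (ler0n R N)) -/(fourth_root N) => h.
have [M0|M0] := leP M 0; first by apply: le_trans M0 _; apply: sqrtr_ge0.
by rewrite -(@ler_pXn2r _ 4) // nnegrE ?sqrtr_ge0 // ltW.
Unshelve. all: by end_near. Qed.

Lemma near_sharpness (M : R) : \forall N \near \oo%classic, M <= sharpness N.
Proof.
have key N : expR (`|M| ^+ 4) + 1 <= N%:R -> M <= sharpness N.
  case: N => [|N]; first by have := expR_gt0 (`|M| ^+ 4); lra.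
  rewrite -natr1 lerD2r => h.
  have N0 : 0 < N%:R :> R by apply: lt_le_trans h; apply: expR_gt0.
  have h4 : `|M| ^+ 4 <= ln N%:R by rewrite -ler_expR lnK.
  have l0 : 0 <= ln N%:R :> R by apply: le_trans h4; apply: exprn_ge0.
  apply: le_trans (ler_norm M) _; rewrite -(@ler_pXn2r _ 4) ?nnegrE ?sqrtr_ge0 //.
  by rewrite /sharpness sqrt_sqrt_exp4.
by near=> N; apply: key; near: N; exact: nbhs_infty_ger.
Unshelve. all: by end_near. Qed.

End GrowthRates.

Section ListDecoding.
Variables (R : realType) (eps gamma : R).

Lemma powR2E (x : R) : 2 `^ x = expR (x * ln 2).
Proof. by rewrite /powR gt_eqF. Qed.

(** Take [x = 1 - 2 eps] in [one_add_sqr_le]; squaring turns the exponent [2 eps] into [4 eps]. *)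
Lemma agreement_prob_le : 0 < eps -> eps < 1 / 2 ->
  (eps ^+ 2 + (1 - eps) ^+ 2) ^+ 2 <= 2 `^ (- (4 * eps)).
Proof.
move=> eps0 eps2; have x01 : 0 <= 1 - 2 * eps <= 1 by apply/andP; split; lra.
have := one_add_sqr_le x01.
have -> : 1 + (1 - 2 * eps) ^+ 2 = 2 * (eps ^+ 2 + (1 - eps) ^+ 2) by ring.
set a := eps ^+ 2 + (1 - eps) ^+ 2 => h.
have a0 : 0 <= a by rewrite addr_ge0 // sqr_ge0.
rewrite powR2E (_ : - (4 * eps) * ln 2 = 2%:R * (- (2 * eps) * ln 2)); last by ring.
rewrite expRM_natl lerXn2r ?nnegrE ?expR_ge0 //.
move: h; rewrite mulrBl mul1r expRD lnK ?posrE // -mulNr.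
by rewrite ler_pM2l.
Qed.

(** The power 3/4 of [N]: above the standard deviation of the weight, yet of order [o(N)]. *)
Definition deviation (N : nat) : R := fourth_root R N ^+ 3.

(** The 1 pays for the factor 2 of [sum_sqr_expect_chi], the next term for the weight enumerator,
    the last for the radius beyond [eps N]. The extra 1 beside the logarithm leaves a factor
    [expR (- deviation N)] for Markov's inequality. *)
Definition list_excess (N : nat) : R :=
  1 + 3 * N%:R / sharpness R N
  + (ln ((1 - eps) / eps) + 1) / ln 2 * deviation N.

Definition list_bound (N : nat) : R :=
  2 `^ (binary_entropy eps * N%:R - gamma * N%:R + list_excess N).

Definition failure_bound (N : nat) : R :=
  if 4 <= sharpness R N then 2 / fourth_root R N else 1.

Lemma weight_enum_doubly_transitive N (D : {set 'rV['F_2]_N}) (t lam : R) :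
  0 < t -> t <= 1 -> 0 < lam <= 1 -> expR (lam * ln 2) = 1 + t ->
  4 <= sharpness R N -> is_code D -> doubly_transitive_set D ->
  ln #|D|%:R <= (1 - lam) * N%:R * ln 2 ->
  weight_enum t D <= expR (3 / sharpness R N * N%:R * ln 2).
Proof.
move=> t0 t1 lam01 lamE r4 cD dtD lnD.
apply: le_trans (weight_enum_le_expect t0 t1 lam01 lamE cD) _; rewrite ler_expR.
(* For lengths 0 and 1 the convention [ln 0 = 0] makes [sharpness] vanish, against [r4]. *)
case: N => [|[|n]] in D r4 cD dtD lnD *.
- by move: r4; rewrite /sharpness ln0 // !sqrtr0; lra.
- by move: r4; rewrite /sharpness ln0 // !sqrtr0; lra.
have l0 : 0 <= ln n.+1%:R :> R by rewrite ln_ge0 // ler1n.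
apply: expect_log_card_le => //; first by case/andP: lam01 => /ltW -> ->.
by rewrite /sharpness sqrt_sqrt_exp4.
Qed.

Lemma expect_competitors_le N (C : {vspace 'rV['F_2]_N}) : 0 < eps -> eps < 1 / 2 ->
  gamma <= 1 - log2 (1 + 2 `^ (- (4 * eps))) ->
  4 <= sharpness R N ->
  doubly_transitive C -> (\dim C)%:R = (1 - gamma) * N%:R :> R ->
  expect eps (fun z => ((hamming_weight z)%:R <= eps * N%:R + deviation N)%R%:R *
    #|near_codewords [set c in C]%SET (eps * N%:R + deviation N) z|%:R) <=
  list_bound N * expR (- deviation N).
Proof.
move=> eps0 eps2 gamma_le r4 dtC dimC; set B := eps * N%:R + deviation N.
have ln2 : 0 < ln 2 :> R by rewrite ln_gt0 // ltr1n.
have eps01 : 0 <= eps <= 1 by apply/andP; split; lra.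
have cC : is_code [set c in C]%SET.
  split=> [|u v]; rewrite !inE; first exact: mem0v.
  exact: memvD.
have dtC' : doubly_transitive_set [set c in C]%SET.
  move=> i j k l ik jl; have [s [si sk sC]] := dtC i j k l ik jl.
  by exists s; split=> // v; rewrite !inE; apply: sC.
pose D := dual_code [set c in C]%SET.
pose t : R := 2 `^ (- (4 * eps)).
have t0 : 0 < t by apply: powR_gt0.
have t1 : t <= 1.
  have e4 : 0 <= 4 * eps by lra.
  by rewrite /t powR2E -[leRHS]expR0 ler_expR mulNr oppr_le0 mulr_ge0 ?(ltW ln2).
(* With this choice the assumption on [gamma] reads [gamma <= 1 - lam], which is the bound on the
   dimension of the dual. *)
pose lam : R := log2 (1 + t).
have lamE : expR (lam * ln 2) = 1 + t.
  by rewrite /lam /log2 divfK ?gt_eqF // lnK // posrE; lra.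
have lam01 : 0 < lam <= 1.
  apply/andP; split; first by apply: divr_gt0 => //; apply: ln_gt0; lra.
  by rewrite /lam /log2 ler_pdivrMr // mul1r ler_ln ?posrE //; lra.
have C2 : ln #|[set c in C]%SET|%:R = (1 - gamma) * N%:R * ln 2 :> R.
  by rewrite card_vspace_F2 natrX lnXn // -dimC -[LHS]mulr_natl.
have N2 : ln ((2 ^ N)%:R : R) = N%:R * ln 2 by rewrite natrX lnXn // -[LHS]mulr_natl.
have C0 : 0 < #|[set c in C]%SET|%:R :> R by rewrite ltr0n card_code_gt0.
have D0 : 0 < #|D|%:R :> R by rewrite ltr0n card_code_gt0 //; apply: is_code_dual.
have lnD : ln #|D|%:R = gamma * N%:R * ln 2 :> R.
  have : ln (#|[set c in C]%SET|%:R * #|D|%:R) = N%:R * ln 2 :> R.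
    by rewrite -natrM card_dual // N2.
  rewrite lnM ?posrE // C2 => h.
  have -> : ln #|D|%:R = N%:R * ln 2 - (1 - gamma) * N%:R * ln 2 :> R by rewrite -h; ring.
  by ring.
have WD : weight_enum t D <= expR (3 / sharpness R N * N%:R * ln 2).
  apply: weight_enum_doubly_transitive t0 t1 lam01 lamE r4 (is_code_dual _) _ _.
    exact: doubly_transitive_dual.
  by rewrite lnD ler_wpM2r ?(ltW ln2) // ler_wpM2r.
have Q0 := expR_ge0 (ln 2 * binary_entropy eps * N%:R + deviation N * ln ((1 - eps) / eps)).
have t01 : 0 <= t <= 1 by rewrite ltW.
have := expect_card_near_codewords eps01 cC Q0 t01 (agreement_prob_le eps0 eps2)
  (fun z => noise_mass_ge eps0 eps2).
rewrite -/B -/D; set E := expect _ _ => h.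
have p2 : 0 < (2 ^ N)%:R :> R by rewrite ltr0n expn_gt0.
rewrite -(ler_pM2l p2); apply: le_trans h _.
have := ler_wpM2l (mulr_ge0 Q0 (ltW C0)) (ler_wpM2l (ler0n R 2) WD).
move=> /le_trans; apply.
have -> : #|[set c in C]%SET|%:R = expR ((1 - gamma) * N%:R * ln 2) :> R.
  by rewrite -C2 lnK.
have -> : (2 ^ N)%:R = expR (N%:R * ln 2) :> R by rewrite -N2 lnK.
have e2 x : 2 * expR x = expR (ln 2 + x) :> R by rewrite expRD lnK // posrE.
rewrite e2 /list_bound powR2E -!expRD ler_expR.
rewrite le_eqVlt; apply/orP; left; apply/eqP; rewrite /list_excess.
have ln2' : ln 2 != 0 :> R by rewrite gt_eqF.
have r0 : sharpness R N != 0 by rewrite gt_eqF //; lra.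
by field; rewrite ln2' r0.
Qed.

(** List all codewords within distance [B], or none if they are too many. Decoding fails only for
    heavy noise or too many competitors, excluded by Chebyshev and Markov at cost [1 / q] each. *)
Lemma list_decoding_code N (C : {vspace 'rV['F_2]_N}) : 0 < eps -> eps < 1 / 2 ->
  gamma <= 1 - log2 (1 + 2 `^ (- (4 * eps))) ->
  doubly_transitive C -> (\dim C)%:R = (1 - gamma) * N%:R :> R ->
  exists T : 'rV['F_2]_N -> {set 'rV['F_2]_N},
    [/\ (forall x, {subset T x <= C}),
        (forall x, #|T x|%:R <= list_bound N) &
        forall c, c \in C ->
          noise_prob eps [set rho | c \notin T (c + rho)]%SET <= failure_bound N].
Proof.
move=> eps0 eps2 gamma_le dtC dimC; have eps01 : 0 <= eps <= 1 by apply/andP; split; lra.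
have k0 : 0 < list_bound N by apply: powR_gt0.
rewrite /failure_bound; case: ifP => r4; last first.
  (* For small [N] the failure bound is 1 and empty lists do. *)
  exists (fun=> finset.set0); split=> [x c|x|c _]; first by rewrite inE.
    by rewrite cards0 ltW.
  rewrite -[leRHS](@expect_cst R eps N); exact: noise_prob_le_expect.
pose B := eps * N%:R + deviation N.
pose S := near_codewords [set c in C]%SET B.
pose T x := if #|S x|%:R <= list_bound N then S x else finset.set0.
exists T; split=> [x c|x|c cC].
- by rewrite /T; case: ifP => _; rewrite !inE // => /andP[].
- by rewrite /T; case: ifP => // _; rewrite cards0 ltW.
have N0 : (0 < N)%N.
  by rewrite lt0n; apply/eqP => N0; move: r4; rewrite /sharpness N0 ln0 // !sqrtr0; lra.
have q1 : 1 <= fourth_root R N.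
  rewrite -[leLHS]sqrtr1 -[X in Num.sqrt X]sqrtr1 /fourth_root !ler_sqrt ?sqrtr_ge0 //.
  by rewrite ler1n.
have q4 : fourth_root R N ^+ 4 = N%:R by apply: sqrt_sqrt_exp4.
set q := fourth_root R N in q1 q4 *.
have q0 : 0 < q by lra.
have dev0 : 0 < deviation N by apply: exprn_gt0.
have cC' : is_code [set c in C]%SET.
  split=> [|u v]; rewrite !inE; first exact: mem0v.
  exact: memvD.
(* [F1] is the Chebyshev majorant of heavy noise, [F2] the Markov majorant of an overlong list. *)
pose F1 (z : 'rV['F_2]_N) := (deviation N ^+ 2)^-1 * ((hamming_weight z)%:R - eps * N%:R) ^+ 2.
pose F2 (z : 'rV['F_2]_N) := (list_bound N)^-1 *
  (((hamming_weight z)%:R <= B)%R%:R * #|S z|%:R).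
have F10 z : 0 <= F1 z by rewrite mulr_ge0 ?sqr_ge0 // invr_ge0 sqr_ge0.
have F20 z : 0 <= F2 z by rewrite mulr_ge0 ?mulr_ge0 // invr_ge0 ltW.
apply: (@le_trans _ _ (expect eps (fun z => F1 z + F2 z))).
  apply: noise_prob_le_expect => // z; first by rewrite addr_ge0.
  rewrite inE => cT; have [wB|wB] := leP (hamming_weight z)%:R B; last first.
    rewrite -[leLHS]addr0 lerD // /F1 mulrC ler_pdivlMr ?exprn_gt0 // mul1r.
    by rewrite lerXn2r ?nnegrE ?(ltW dev0) //; move: wB; rewrite /B; lra.
  rewrite -[leLHS]add0r lerD // /F2 wB mul1r mulrC ler_pdivlMr // mul1r.
  have cS : c \in [set c in C]%SET by rewrite inE.
  rewrite /S -(card_near_codewords_shift _ _ cC' cS).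
  rewrite leNgt; apply: contra cT => /ltW le_k; rewrite /T le_k inE inE cC /=.
  by rewrite addrA row2_addxx add0r.
rewrite expectD !expectZ variance_hamming_weight.
have F1le : (deviation N ^+ 2)^-1 * (N%:R * (eps * (1 - eps))) <= q^-1.
  rewrite -q4 mulrC -exprVn /deviation -/q.
  have -> : q ^+ 4 * (eps * (1 - eps)) * (q ^+ 3)^-1 ^+ 2 = q^-1 * (q^-1 * (eps * (1 - eps))).
    by field; rewrite gt_eqF.
  rewrite -[leRHS]mulr1 ler_wpM2l ?invr_ge0 ?(ltW q0) //.
  have qV : q^-1 <= 1 by rewrite invf_le1.
  have qV0 : 0 <= q^-1 by rewrite invr_ge0 ltW.
  rewrite -[leRHS](mulr1 1) ler_pM //; nra.
have F2le : (list_bound N)^-1 * expect eps (fun z : 'rV['F_2]_N =>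
    ((hamming_weight z)%:R <= B)%R%:R * #|S z|%:R) <= q^-1.
  rewrite mulrC ler_pdivrMr //.
  apply: le_trans (expect_competitors_le eps0 eps2 gamma_le r4 dtC dimC) _.
  rewrite mulrC ler_wpM2r ?(ltW k0) // expRN lef_pV2 ?posrE ?expR_gt0 //.
  apply: le_trans (expR_ge1Dx _); rewrite /deviation -/q.
  have : q ^+ 1 <= q ^+ 3 by apply: ler_weXn2l.
  by rewrite expr1; lra.
by rewrite mulrDl mul1r lerD.
Qed.

Lemma list_excess_littleo : (list_excess =o_\oo (fun N : nat => N%:R : R))%classic.
Proof.
apply/eqoP => d d0.
set K := (ln ((1 - eps) / eps) + 1) / ln 2.
near=> N.
have h1 : 3 / d <= N%:R by near: N; exact: nbhs_infty_ger.
have h2 : 9 / d <= sharpness R N by near: N; exact: near_sharpness.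
have h3 : 3 * `|K| / d + 1 <= fourth_root R N by near: N; exact: near_fourth_root.
have q4 : fourth_root R N ^+ 4 = N%:R by apply: sqrt_sqrt_exp4.
move: h1 h2 h3 q4; rewrite /list_excess -/K /deviation.
set q := fourth_root R N; set r := sharpness R N => h1 h2 h3 q4.
have q0 : 0 < q by apply: lt_le_trans h3; rewrite ltr_wpDl // divr_ge0 ?mulr_ge0 // ltW.
have r0 : 0 < r by apply: lt_le_trans h2; apply: divr_gt0.
have i1 : 1 <= d / 3 * N%:R by move: h1; rewrite ler_pdivrMr // => h1; lra.
have i2 : 3 * N%:R / r <= d / 3 * N%:R.
  rewrite mulrAC ler_wpM2r // ler_pdivrMr //.
  by move: h2; rewrite ler_pdivrMr // => h2; lra.
have i3 : `|K * q ^+ 3| <= d / 3 * N%:R.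
  rewrite normrM (ger0_norm (exprn_ge0 3 (ltW q0))) -q4 [q ^+ 4]exprS [leRHS]mulrA.
  rewrite ler_wpM2r ?exprn_ge0 ?(ltW q0) //.
  have : 3 * `|K| / d <= q by lra.
  by rewrite ler_pdivrMr // => h; lra.
rewrite [`|N%:R|]ger0_norm //.
apply: le_trans (ler_normD _ _) _.
rewrite ger0_norm; last by rewrite addr_ge0 // divr_ge0 ?mulr_ge0 // ltW.
by lra.
Unshelve. all: by end_near. Qed.

Lemma failure_bound_cvg0 : (failure_bound @ \oo --> (0 : R))%classic.
Proof.
apply/cvgrPdist_le => d d0; near=> N.
rewrite /failure_bound sub0r normrN ifT; last by near: N; exact: near_sharpness.
have h : 2 / d <= fourth_root R N by near: N; exact: near_fourth_root.
have q0 : 0 < fourth_root R N by apply: lt_le_trans h; apply: divr_gt0.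
rewrite ger0_norm ?divr_ge0 ?(ltW q0) // ler_pdivrMr // mulrC.
by rewrite -ler_pdivrMr.
Unshelve. all: by end_near. Qed.

End ListDecoding.

Local Open Scope classical_set_scope.

Theorem theorem1p4 (R : realType) (eps gamma : R) :
  0 < eps -> eps < 1 / 2 ->
  gamma <= 1 - log2 (1 + 2 `^ (- (4 * eps))) ->
  exists k p e : nat -> R,
    [/\ e =o_\oo (fun N : nat => N%:R : R),
        (forall N : nat,
           k N = 2 `^ (binary_entropy eps * N%:R - gamma * N%:R + e N)),
        p @ \oo --> (0 : R) &
        forall (N : nat) (C : {vspace 'rV['F_2]_N}),
          doubly_transitive C ->
          (\dim C)%:R = (1 - gamma) * N%:R :> R ->
          exists T : 'rV['F_2]_N -> {set 'rV['F_2]_N},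
            [/\ (forall x, {subset T x <= C}),
                (forall x, #|T x|%:R <= k N) &
                forall c, c \in C ->
                  noise_prob eps [set rho | c \notin T (c + rho)]%SET <= p N]].
Proof.
move=> eps0 eps2 gamma_le.
exists (list_bound eps gamma), (@failure_bound R), (list_excess eps); split=> //.
- exact: list_excess_littleo.
- exact: failure_bound_cvg0.
- by move=> N C; apply: list_decoding_code.
Qed.
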